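(* Let $L$ be a prime Lie algebra over a field $k$ of characteristic zero satisfying the standard Lie identity of degree $5$. Then there exist a prime commutative differential $k$-algebra $A$ and an injective homomorphism of Lie algebras over $k$ from $L$ to the Lie algebra of special derivations $\mathrm{Diff}\, A$.
   Context: A differential $k$-algebra is a commutative associative $k$-algebra $A$, not necessarily with identity, equipped with a specified $k$-linear derivation $a\mapsto a'$. A differential ideal is an ideal $I$ with $a'\in I$ for all $a\in I$. A differential algebra $A$ is prime if $I\cdot J\neq 0$ for any nonzero differential ideals $I,J$ of $A$. The Lie algebra of special derivations of $A$ is $\mathrm{Diff}\, A=\{a\partial \mid a\in A\}$ (a copy of the vector space $A$) with bracket $[a\partial,b\partial]=(ab'-a'b)\partial$. A Lie algebra $L$ is prime if $[I,J]\neq 0$ for any nonzero ideals $I,J\subset L$. A Lie algebra $L$ satisfies the standard Lie identity of degree $5$ ($\mathrm{St}_5$) if $$\sum_{\sigma\in S_4}(-1)^{\sigma}\,\mathrm{ad}\,x_{\sigma(1)}\,\mathrm{ad}\,x_{\sigma(2)}\,\mathrm{ad}\,x_{\sigma(3)}\,\mathrm{ad}\,x_{\sigma(4)}\,z=0$$ for all $x_1,x_2,x_3,x_4,z\in L$, where $(-1)^\sigma$ is the sign of $\sigma$. *)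

(* Defs.v *)
From HB Require Import structures.
From mathcomp Require Import all_boot all_order all_fingroup all_algebra.

Set Implicit Arguments.
Unset Strict Implicit.
Unset Printing Implicit Defensive.

Import GRing.Theory.
Local Open Scope ring_scope.

(* MathComp has neither Lie algebras nor algebras without identity; both are
   set up here on top of left modules over a field.  Ideals are Prop-valued
   predicates, so that no decidability of membership is assumed. *)

Section Ideals.
Variables (k : fieldType) (V : lmodType k).
Implicit Types (op : V -> V -> V) (I J : V -> Prop).

Definition subspace I : Prop :=
  I 0 /\ forall (c : k) (u v : V), I u -> I v -> I (c *: u + v).

Definition ideal op I : Prop :=
  subspace I /\ forall a x : V, I x -> I (op a x) /\ I (op x a).

Definition nonzero I : Prop := exists2 x : V, I x & x <> 0.

(* The linear span of all op x y with x in I and y in J; no scalars are needed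
   since I and J will be subspaces and op bilinear. *)
Definition product op I J (z : V) : Prop :=
  exists (n : nat) (x y : 'I_n -> V),
    [/\ forall i, I (x i), forall i, J (y i) & z = \sum_(i < n) op (x i) (y i)].

End Ideals.

HB.mixin Record isLieAlgebra (k : fieldType) L of GRing.Lmodule k L := {
  bracket : L -> L -> L;
  bracket_bilinear : bilinear_for *:%R *:%R bracket;
  bracket_alt : forall x : L, bracket x x = 0;
  bracket_jacobi : forall x y z : L,
    bracket x (bracket y z) + bracket y (bracket z x)
      + bracket z (bracket x y) = 0
}.

#[short(type="lieAlgType")]
HB.structure Definition LieAlgebra (k : fieldType) :=
  {L of isLieAlgebra k L & GRing.Lmodule k L}.

HB.mixin Record isDiffAlgebra (k : fieldType) A of GRing.Lmodule k A := {
  dmul : A -> A -> A;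
  dmul_bilinear : bilinear_for *:%R *:%R dmul;
  dmulA : associative dmul;
  dmulC : commutative dmul;
  der : A -> A;
  der_linear : linear der;
  der_leibniz : forall a b : A, der (dmul a b) = dmul (der a) b + dmul a (der b)
}.

(* Commutative associative algebras, not necessarily with identity, equipped
   with a derivation. *)
#[short(type="diffAlgType")]
HB.structure Definition DiffAlgebra (k : fieldType) :=
  {A of isDiffAlgebra k A & GRing.Lmodule k A}.

Section LieNotions.
Variables (k : fieldType) (L : lieAlgType k).

Definition lie_prime : Prop :=
  forall I J : L -> Prop,
    ideal (@bracket k L) I -> nonzero I ->
    ideal (@bracket k L) J -> nonzero J ->
    nonzero (product (@bracket k L) I J).

Definition ad (x : L) : L -> L := bracket x.

Definition St5 : Prop :=
  forall (x : 'I_4 -> L) (z : L),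
    \sum_(s : 'S_4) (-1) ^+ s *:
       ad (x (s 0)) (ad (x (s 1)) (ad (x (s 2)) (ad (x (s 3)) z))) = 0.

End LieNotions.

Definition lie_morphism (k : fieldType) (L M : lieAlgType k) (f : L -> M) :
    Prop :=
  linear f /\ {morph f : x y / bracket x y}.

Section DiffNotions.
Variables (k : fieldType) (A : diffAlgType k).

Definition diff_ideal (I : A -> Prop) : Prop :=
  ideal (@dmul k A) I /\ forall a : A, I a -> I (der a).

Definition diff_prime : Prop :=
  forall I J : A -> Prop,
    diff_ideal I -> nonzero I -> diff_ideal J -> nonzero J ->
    nonzero (product (@dmul k A) I J).

Definition diff_bracket (a b : A) : A := dmul a (der b) - dmul (der a) b.

Let dmulDr (a b c : A) : dmul a (b + c) = dmul a b + dmul a c.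
Proof. by have := (dmul_bilinear (s := A)).2 a 1 b c; rewrite /= !scale1r. Qed.

Let dmulZr (a b : A) (x : k) : dmul a (x *: b) = x *: dmul a b.
Proof.
have m0 : dmul a 0 = 0 by apply: (addIr (dmul a 0)); rewrite -dmulDr !add0r.
by have := (dmul_bilinear (s := A)).2 a x b 0; rewrite /= m0 !addr0.
Qed.

Let dmulDl (a b c : A) : dmul (b + c) a = dmul b a + dmul c a.
Proof. by rewrite !(dmulC _ a) dmulDr. Qed.

Let dmulZl (a b : A) (x : k) : dmul (x *: b) a = x *: dmul b a.
Proof. by rewrite !(dmulC _ a) dmulZr. Qed.

Let dmulNr (a b : A) : dmul a (- b) = - dmul a b.
Proof. by rewrite -scaleN1r dmulZr scaleN1r. Qed.

Let derD (a b : A) : der (a + b) = der a + der b.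
Proof. by have := der_linear 1 a b; rewrite !scale1r. Qed.

Let derN (a : A) : der (- a) = - der a.
Proof.
have d0 : der (0 : A) = 0 by apply: (addIr (der 0)); rewrite -derD !add0r.
by apply: (addIr (der a)); rewrite -derD !addNr d0.
Qed.

Fact diff_bracket_bilinear : bilinear_for *:%R *:%R diff_bracket.
Proof.
split=> [b x a c | a x b c] /=; rewrite /diff_bracket der_linear.
  by rewrite !dmulDl !dmulZl opprD addrACA scalerBr.
by rewrite !dmulDr !dmulZr opprD addrACA scalerBr.
Qed.

Fact diff_bracket_alt (a : A) : diff_bracket a a = 0.
Proof. by rewrite /diff_bracket dmulC subrr. Qed.

Let diff_bracket2E (a b c : A) :
  diff_bracket a (diff_bracket b c) =
    (dmul (dmul a b) (der (der c)) - dmul (dmul c a) (der (der b)))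
    + (dmul c (dmul (der a) (der b)) - dmul b (dmul (der c) (der a))).
Proof.
rewrite /diff_bracket derD derN !der_leibniz.
rewrite [dmul (der b) (der c) + _]addrC opprD addrA addrAC addrK.
rewrite !dmulDr !dmulNr opprD opprK [- _ + dmul (der a) _]addrC.
congr (_ - _ + (_ - _)).
- by rewrite dmulA.
- by rewrite (dmulC (der _) c) dmulA (dmulC a).
- by rewrite dmulA dmulC.
- by rewrite dmulA (dmulC (der a)) -dmulA (dmulC (der c)).
Qed.

Fact diff_bracket_jacobi (a b c : A) :
  diff_bracket a (diff_bracket b c) + diff_bracket b (diff_bracket c a)
    + diff_bracket c (diff_bracket a b) = 0.
Proof.
have cyc (x y z : A) : (x - y) + (z - x) + (y - z) = 0.
  by rewrite addrAC [x - y + _]addrA subrK -(opprB x z) subrr.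
by rewrite !diff_bracket2E [X in X + _]addrACA [LHS]addrACA !cyc addr0.
Qed.

End DiffNotions.

(* The element a of Diff A stands for the special derivation "a times der". *)
Definition Diff (k : fieldType) (A : diffAlgType k) : Type := A.

HB.instance Definition _ (k : fieldType) (A : diffAlgType k) :=
  GRing.Lmodule.on (Diff A).

HB.instance Definition _ (k : fieldType) (A : diffAlgType k) :=
  isLieAlgebra.Build k (Diff A) (@diff_bracket_bilinear k A)
    (@diff_bracket_alt k A) (@diff_bracket_jacobi k A).

(* Main.v *)
(* For x, y, z in L let T x y z be the alternating sum of the products of ad x,
   ad y, ad z.  In the Lie algebra of special derivations of a differential
   algebra it is the multiplication by a multiple of the Wronskian of x, y, z.
   Over an arbitrary L, two instances of St5 give
     delta_a r b = delta_b r a,    delta_a r := [ad a, r],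
   for all r in the span of the operators T x y z.  This single identity implies
   that these operators commute and that L acts on them by derivations of rank
   one: delta_a r * delta_b s = delta_b r * delta_a s.

   A "point" is a linear map xi from L to commuting operators such that
     xi x * xi [y, z] + xi y * xi [z, x] + xi z * xi [x, y] = 0,
   together with a base element c of L.  Dividing by xi c the Taylor series of
   xi along the flow of c gives a homomorphism from L to Diff B, and xi a / xi c
   vanishes only if (xi c)^m xi a = 0 for some m.  Collecting all points into
   one localization, L embeds into some Diff B as soon as for all a <> 0 and m
   some point has (xi c)^m xi a <> 0.  The exponent matters: every single xi c
   may be nilpotent.  The quotient of B by a differential ideal which is maximal
   among those meeting L trivially is then prime, because L is.

   If some delta_c r is nonzero, the maps xi a = delta_a r are points, and there
   are enough of them by polarization and primeness.  Otherwise the T x y z lie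
   in the centroid, L has rank three over it (a form of sl2), and xi is given by
   an isotropic vector over a quadratic extension of the centroid. *)
From HB Require Import structures.
Require Import Defs.
From mathcomp Require Import all_boot all_order all_fingroup all_algebra ring.
From mathcomp Require Import generic_quotient boolp classical_sets functions.

Set Implicit Arguments.
Unset Strict Implicit.
Unset Printing Implicit Defensive.

Import GRing.Theory.
Local Open Scope ring_scope.
Local Open Scope quotient_scope.

(** * A decision procedure for identities in abelian groups *)

Inductive zexp :=
  | ZVar of nat | ZZero | ZAdd of zexp & zexp | ZOpp of zexp | ZMul of zexp &
    nat.

Fixpoint zeval (V : zmodType) (env : seq V) (e : zexp) : V :=
  match e with
  | ZVar n => env`_n
  | ZZero => 0
  | ZAdd e1 e2 => zeval env e1 + zeval env e2
  | ZOpp e1 => - zeval env e1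
  | ZMul e1 n => zeval env e1 *+ n
  end.

Fixpoint zcoef (e : zexp) (i : nat) : int :=
  match e with
  | ZVar n => (n == i)%:Z
  | ZZero => 0
  | ZAdd e1 e2 => zcoef e1 i + zcoef e2 i
  | ZOpp e1 => - zcoef e1 i
  | ZMul e1 n => zcoef e1 i *+ n
  end.

Fixpoint zbound (m : nat) (e : zexp) : bool :=
  match e with
  | ZVar n => (n < m)%N
  | ZZero => true
  | ZAdd e1 e2 => zbound m e1 && zbound m e2
  | ZOpp e1 => zbound m e1
  | ZMul e1 _ => zbound m e1
  end.

Lemma zevalE (V : zmodType) (env : seq V) (e : zexp) :
  zbound (size env) e ->
  zeval env e = \sum_(i < size env) env`_i *~ zcoef e i.
Proof.
elim: e => [n|_|e1 IH1 e2 IH2|e1 IH1|e1 IH1 n] /=.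
- move=> n_lt; rewrite (bigD1 (Ordinal n_lt)) //= eqxx mulr1z big1 ?addr0 //.
  by move=> i; rewrite -val_eqE /= eq_sym => /negbTE->; rewrite mulr0z.
- by rewrite big1 // => i _; rewrite mulr0z.
- case/andP=> /IH1-> /IH2->; rewrite -big_split /=.
  by apply: eq_bigr => i _; rewrite mulrzDr.
- by move/IH1->; rewrite -sumrN; apply: eq_bigr => i _; rewrite mulrNz.
- move/IH1->; rewrite -sumrMnl; apply: eq_bigr => i _.
  by rewrite pmulrn -mulrzA -mulrzz mulrzz pmulrn mulrzz.
Qed.

Definition zcheck (m : nat) (e1 e2 : zexp) : bool :=
  [&& zbound m e1, zbound m e2
    & all (fun i => zcoef e1 i == zcoef e2 i) (iota 0 m)].

(** Each side is determined by its integer coefficients at the atoms, so comparing these by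
    computation settles the identity. *)
Lemma zcheckP (V : zmodType) (env : seq V) (e1 e2 : zexp) :
  zcheck (size env) e1 e2 -> zeval env e1 = zeval env e2.
Proof.
case/and3P=> b1 b2 /allP eqc; rewrite !zevalE //; apply: eq_bigr => i _.
by rewrite (eqP (eqc i _)) // mem_iota /=.
Qed.

(* The same scaling may be elaborated through two structure paths, which do not
   match syntactically: hence the unification. *)
Ltac zindex x env :=
  match env with
  | x :: _ => constr:(0%N)
  | (?c *: ?y)%R :: _ =>
    let _ := match x with (c *: y)%R => unify x (c *: y)%R end in constr:(0%N)
  | _ :: ?env' => let n := zindex x env' in constr:(S n)
  end.

Ltac zmem x env :=
  match goal with
  | _ => let n := zindex x env in constr:(true)
  | _ => constr:(false)
  end.

Ltac zatoms env t :=
  lazymatch t with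
  | (?a + ?b)%R => let env1 := zatoms env a in zatoms env1 b
  | (- ?a)%R => zatoms env a
  | (?a *+ _)%R => zatoms env a
  | 0%R => env
  | _ => lazymatch zmem t env with
         | true => env
         | false => constr:(t :: env)
         end
  end.

Ltac zquote env t :=
  lazymatch t with
  | (?a + ?b)%R => let x := zquote env a in let y := zquote env b in
                   constr:(ZAdd x y)
  | (- ?a)%R => let x := zquote env a in constr:(ZOpp x)
  | (?a *+ ?n)%R => let x := zquote env a in constr:(ZMul x n)
  | 0%R => constr:(ZZero)
  | _ => let n := zindex t env in constr:(ZVar n)
  end.

Ltac abel :=
  lazymatch goal with
  | |- @eq ?V ?a ?b =>
    let env0 := zatoms (@nil V) a in
    let env := zatoms env0 b in
    let x := zquote env a in
    let y := zquote env b in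
    apply: (@zcheckP _ env x y); vm_compute; reflexivity
  end.

(** Serves to deduce a goal from a known equation: [abel] then checks that the two differences
    coincide. *)
Lemma eq_of_sub (V : zmodType) (a b c d : V) : c = d -> a - b = c - d -> a = b.
Proof. by move=> ->; rewrite subrr => /eqP; rewrite subr_eq0 => /eqP. Qed.

(** * Lie algebras *)

Section Bracket.
Variables (k : fieldType) (L : lieAlgType k).
Implicit Types x y z : L.
Notation "[ 'l' x , y ]" := (@bracket k L x y) (format "[ 'l'  x ,  y ]").

Lemma bracketDr x y z : [l x, y + z] = [l x, y] + [l x, z].
Proof. by have := (bracket_bilinear (s := L)).2 x 1 y z;
  rewrite /= !scale1r. Qed.

Lemma bracketDl x y z : [l y + z, x] = [l y, x] + [l z, x].
Proof. by have := (bracket_bilinear (s := L)).1 x 1 y z;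
  rewrite /= !scale1r. Qed.

Lemma bracket0r x : [l x, 0] = 0.
Proof. by apply: (addIr [l x, 0]); rewrite -bracketDr !add0r. Qed.

Lemma bracket0l x : [l 0, x] = 0.
Proof. by apply: (addIr [l 0, x]); rewrite -bracketDl !add0r. Qed.

Lemma bracketZr c x y : [l x, c *: y] = c *: [l x, y].
Proof.
by have := (bracket_bilinear (s := L)).2 x c y 0; rewrite /= bracket0r !addr0.
Qed.

Lemma bracketZl c x y : [l c *: x, y] = c *: [l x, y].
Proof.
by have := (bracket_bilinear (s := L)).1 y c x 0; rewrite /= bracket0l !addr0.
Qed.

Lemma bracketNr x y : [l x, - y] = - [l x, y].
Proof. by rewrite -scaleN1r bracketZr scaleN1r. Qed.

Lemma bracketNl x y : [l - x, y] = - [l x, y].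
Proof. by rewrite -scaleN1r bracketZl scaleN1r. Qed.

Lemma bracketC x y : [l x, y] = - [l y, x].
Proof.
apply/eqP; rewrite -addr_eq0 -[X in _ == X](bracket_alt (x + y)).
by rewrite bracketDr !bracketDl !bracket_alt addr0 add0r addrC.
Qed.

Lemma bracketA x y z : [l [l x, y], z] = [l x, [l y, z]] - [l y, [l x, z]].
Proof.
have := bracket_jacobi x y z; rewrite (bracketC z x) (bracketC z) bracketNr.
by move/eqP; rewrite subr_eq0 => /eqP.
Qed.

End Bracket.

(** * Expansion of alternating sums over symmetric groups *)

Section AlternatingSum.
Variables (k : fieldType) (X : Type) (V : lmodType k).

(** The summand is a function of the list of arguments, so that an expansion can peel off the
    head. *)
Definition altsum n (x : 'I_n -> X) (G : seq X -> V) : V :=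
  \sum_(s : 'S_n) (-1) ^+ s *: G [seq x (s i) | i <- enum 'I_n].

Lemma altsum0 (x : 'I_0 -> X) G : altsum x G = G [::].
Proof.
rewrite /altsum (bigD1 1%g) //= big1 ?addr0; last first.
  by move=> s /eqP[]; apply/permP=> -[].
rewrite odd_perm1 scale1r; congr G; apply: size0nil.
by rewrite size_map -cardE card_ord.
Qed.

(** A permutation of [n.+1] points amounts to the image [j] of the first point and a permutation of
    the other [n]; the sign is [(-1) ^+ j] times the sign of the latter. *)
Lemma altsumS n (x : 'I_n.+1 -> X) G :
  altsum x G =
    \sum_(j < n.+1)
      (-1) ^+ j *: altsum (fun i => x (lift j i)) (fun l => G (x j :: l)).
Proof.
pose h (p : 'I_n.+1 * 'S_n) := lift_perm ord0 p.1 p.2.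
have h_inj : injective h.
  move=> [i s] [j t] /permP eq_st; have := eq_st ord0; rewrite !lift_perm_id.
  move=> eq_ij; move: eq_ij eq_st => /= <- eq_st; congr pair; apply/permP=> m.
  by apply: (@lift_inj _ i); have := eq_st (lift ord0 m);
    rewrite !lift_perm_lift.
have h_bij : bijective h.
  by apply: inj_card_bij => //; rewrite card_prod card_ord !card_Sn factS.
pose F j s := (-1) ^+ h (j, s) *: G [seq x (h (j, s) i) | i <- enum 'I_n.+1].
rewrite /altsum (reindex h) /=; last exact: onW_bij.
rewrite (eq_bigr (fun p => F p.1 p.2)) => [|[] //]; rewrite -pair_bigA /=.
apply: eq_bigr => j _; rewrite scaler_sumr; apply: eq_bigr => s _.
rewrite /F /h odd_lift_perm /= signr_addb signr_odd scalerA; congr (_ *: G _).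
rewrite enum_ordSl /= lift_perm_id; congr cons.
by rewrite -map_comp; apply: eq_map => i /=; rewrite lift_perm_lift.
Qed.

End AlternatingSum.

(** * Identities between the operators [T] *)

Section Identities.
Variables (k : fieldType) (L : lieAlgType k).
Implicit Types a b u v w x y z : L.
Notation "[ 'l' x , y ]" := (@bracket k L x y) (format "[ 'l'  x ,  y ]").

Definition T x y z w : L :=
  [l x, [l [l y, z], w]] + [l y, [l [l z, x], w]] + [l z, [l [l x, y], w]].

(** The sum over ['S_4] is expanded along its outermost factor; the inner alternating sums over
    three letters are values of [T]. *)
Lemma St5E (st5 : St5 L) x y z u w :
  [l x, T y z u w] - [l y, T x z u w] + [l z, T x y u w] - [l u, T x y z w] = 0.
Proof.
pose X (i : 'I_4) := nth 0 [:: x; y; z; u] i.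
rewrite -[RHS](st5 X w) /ad.
transitivity (altsum X (fun l => foldr (@bracket k L) w l)); last first.
  apply: eq_bigr => s _; congr (_ *: _).
  have -> : enum 'I_4 = [:: 0; 1; 2%R; 3%R].
    by apply: (inj_map val_inj); rewrite val_enum_ord.
  by [].
rewrite !(altsumS, big_ord_recl, big_ord0) !altsum0 /X /= /bump /= !(addn0,
  add1n).
rewrite !(expr0, expr1, scale1r, scaler0, addr0, scaleN1r, exprS, mulr1,
  mulN1r, opprK).
rewrite /T !bracketA !(bracketDr, bracketNr).
abel.
Qed.

(* The difference of two instances of St5 is an identity of Lie algebras. *)
Lemma bracket_T (st5 : St5 L) x y z a w :
  [l T x y z a, w] + [l a, T x y z w] = T x y z [l a, w] *+ 2.
Proof.
have := congr2 (fun s t => s - t) (St5E st5 x y z a w) (St5E st5 x y z w a).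
rewrite subrr => e; apply/eqP; rewrite -subr_eq0 -oppr_eq0 -[X in _ == X]e.
apply/eqP.
rewrite /T !(bracketC w) !(bracketA, bracketDr, bracketNr, bracketDl,
  bracketNl).
rewrite !(bracketC w) !(bracketA, bracketDr, bracketNr, bracketDl, bracketNl).
abel.
Qed.

(** Holds in every Lie algebra. Once the operators [T] lie in the centroid it becomes Cramer's rule,
    giving the coordinates of [w] in a frame [x], [y], [z]. *)
Lemma T_perm4 x y z w : T x y z w = T w y z x + T x w z y + T x y w z.
Proof.
rewrite /T !(bracketC w) !(bracketA, bracketDr, bracketNr, bracketDl,
  bracketNl).
rewrite !(bracketC w) !(bracketA, bracketDr, bracketNr, bracketDl, bracketNl).
abel.
Qed.

(** Shows that the vanishing of all [T] forces strong relations in the derived algebra. *)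
Lemma T_diag x y w : T x y w w = - ([l [l w, x], [l w, y]] *+ 2).
Proof.
rewrite /T !(bracketC y) !(bracketA, bracketDr, bracketNr, bracketDl,
  bracketNl).
rewrite !(bracketC y) !(bracketA, bracketDr, bracketNr, bracketDl, bracketNl).
abel.
Qed.

Lemma bracket_TE a x y z w :
  [l a, T x y z w] =
    T x y z [l a, w] + (T [l a, x] y z w + T x [l a, y] z w + T x y [l a, z] w).
Proof.
rewrite /T !(bracketA, bracketDr, bracketNr, bracketDl, bracketNl).
abel.
Qed.

End Identities.

Lemma mulrSn_eq0 (k : fieldType) (V : lmodType k) (n : nat) (v : V) :
  [pchar k] =i pred0 -> v *+ n.+1 = 0 -> v = 0.
Proof.
move=> /pcharf0P char0 /eqP; rewrite -scaler_nat scaler_eq0 char0 /=.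
by move/eqP.
Qed.

Section LinearMaps.
Variables (k : fieldType) (V W : lmodType k) (r : V -> W).
Hypothesis r_lin : linear r.

Lemma lin_add u v : r (u + v) = r u + r v.
Proof. by have := r_lin 1 u v; rewrite !scale1r. Qed.

Lemma lin_zero : r 0 = 0.
Proof. by apply: (addIr (r 0)); rewrite -lin_add !add0r. Qed.

Lemma lin_scale c v : r (c *: v) = c *: r v.
Proof. by have := r_lin c v 0; rewrite lin_zero !addr0. Qed.

Lemma lin_opp v : r (- v) = - r v.
Proof. by rewrite -scaleN1r lin_scale scaleN1r. Qed.

End LinearMaps.

(** * The span of the operators [T]: symmetry and commutativity *)

Section Tspan.
Variables (k : fieldType) (L : lieAlgType k).
Implicit Types (a b u v w x y z : L) (r s : L -> L).
Notation "[ 'l' x , y ]" := (@bracket k L x y) (format "[ 'l'  x ,  y ]").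

Lemma TC x y z w : T y x z w = - T x y z w.
Proof. by rewrite /T (bracketC y x) (bracketC z y) (bracketC x z) !bracketNl
  !bracketNr; abel. Qed.

Lemma Tcycle x y z w : T y z x w = T x y z w.
Proof. by rewrite /T; abel. Qed.

Lemma Txx x z w : T x x z w = 0.
Proof.
by rewrite /T bracket_alt bracket0l bracket0r (bracketC z x) bracketNl
  bracketNr; abel.
Qed.

Lemma T_linear x y z : linear (T x y z).
Proof.
move=> c u v; rewrite /T !(bracketDr, bracketZr) !scalerDr; abel.
Qed.

Lemma T_linear3 x y w : linear (fun z => T x y z w).
Proof.
move=> c u v; rewrite /T !(bracketDr, bracketDl, bracketZl, bracketZr)
  !scalerDr.
abel.
Qed.

Definition delta a r v := [l a, r v] - r [l a, v].

Inductive Tspan : (L -> L) -> Prop :=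
  | Tspan_T x y z : Tspan (T x y z)
  | Tspan_add r s : Tspan r -> Tspan s -> Tspan (fun v => r v + s v)
  | Tspan_scale c r : Tspan r -> Tspan (fun v => c *: r v).

Lemma Tspan_linear r : Tspan r -> linear r.
Proof.
elim=> [x y z|r1 r2 _ IH1 _ IH2|c r1 _ IH] d u v; first exact: T_linear.
  by rewrite IH1 IH2 scalerDr addrACA.
by rewrite IH scalerDr !scalerA mulrC.
Qed.

(** By the Leibniz rule [bracket_TE], commutation with [ad a] acts on the three indices of [T].
    Hence every fact about the span also applies to iterated [delta]. *)
Lemma Tspan_delta a r : Tspan r -> Tspan (delta a r).
Proof.
elim=> [x y z|r1 r2 _ IH1 _ IH2|c r1 _ IH].
- have -> : delta a (T x y z) = fun v =>
      (T [l a, x] y z v + T x [l a, y] z v) + T x y [l a, z] v.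
    by apply: funext => v; rewrite /delta bracket_TE addrC addKr.
  by apply: Tspan_add (Tspan_T _ _ _);
    apply: Tspan_add (Tspan_T _ _ _) (Tspan_T _ _ _).
- have -> : delta a (fun v => r1 v + r2 v) = fun v =>
    delta a r1 v + delta a r2 v.
    by apply: funext => v; rewrite /delta bracketDr; abel.
  exact: Tspan_add.
- have -> : delta a (fun v => c *: r1 v) = fun v => c *: delta a r1 v.
    by apply: funext => v; rewrite /delta bracketZr scalerBr.
  exact: Tspan_scale.
Qed.

Lemma delta_bracket r a b v : Tspan r ->
  delta [l a, b] r v = delta a (delta b r) v - delta b (delta a r) v.
Proof.
move=> /Tspan_linear r_lin; rewrite /delta !bracketDr !bracketNr.
rewrite !bracketA (lin_add r_lin) (lin_opp r_lin).
abel.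
Qed.

Lemma delta_linear r v : Tspan r -> linear (fun a => delta a r v).
Proof.
move=> /Tspan_linear r_lin c a b.
rewrite /delta !bracketDl !bracketZl r_lin scalerBr; abel.
Qed.

Lemma bracket_delta r a v : [l a, r v] = r [l a, v] + delta a r v.
Proof. by rewrite /delta addrC subrK. Qed.

Hypotheses (char0 : [pchar k] =i pred0) (st5 : St5 L).

(** On a generator this is [bracket_T] rearranged, and both sides are linear in [r]. *)
Lemma delta_sym r a b : Tspan r -> delta a r b = delta b r a.
Proof.
elim=> [x y z|r1 r2 _ IH1 _ IH2|c r1 _ IH].
- have := bracket_T st5 x y z b a.
  rewrite /delta (bracketC b (T _ _ _ _)) (bracketC b a) (lin_opp (T_linear x y
    z)).
  rewrite (bracketC (T x y z b)).
  move=> e; apply/eqP; rewrite -subr_eq0; apply/eqP.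
  transitivity (- T x y z [l a, b] *+ 2 - (- [l a, T x y z b] - [l T x y z a,
    b])).
    abel.
  by rewrite e subrr.
- by rewrite /delta !bracketDr; move: IH1 IH2; rewrite /delta => e1 e2;
    rewrite opprD addrACA e1 e2 [in RHS]opprD addrACA.
- by rewrite /delta !bracketZr -!scalerBr; congr (_ *: _).
Qed.

(** By symmetry each term is [delta] of a bracket and splits into two second-order terms;
    [delta a (delta b r) c] is symmetric in [a] and [c], so the six terms cancel in pairs. *)
Lemma delta_cycle r u v w : Tspan r ->
  delta w r [l u, v] + delta u r [l v, w] + delta v r [l w, u] = 0.
Proof.
move=> rT; rewrite (delta_sym w _ rT) (delta_sym u _ rT) (delta_sym v _ rT)
  !delta_bracket //.
have e a b c : delta a (delta b r) c = delta c (delta b r) a.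
  by apply: delta_sym; apply: Tspan_delta.
rewrite (e u v w) (e v u w) (e v w u).
abel.
Qed.

Lemma Tspan_commT r x y z v : Tspan r -> r (T x y z v) = T x y z (r v).
Proof.
move=> rT; have r_lin := Tspan_linear rT.
pose D2 a b c := delta a (delta b r) c.
have D2C a b c : D2 a b c = D2 c b a by apply: delta_sym; apply: Tspan_delta.
have D2l a b d : delta [l a, b] r d = D2 a b d - D2 b a d by exact:
  delta_bracket.
have r_bracket a b : r [l a, b] = [l a, r b] - delta a r b by rewrite /delta
  opprB addrC subrK.
have cyc1 : D2 x v [l y, z] + D2 y v [l z, x] + D2 z v [l x, y] = 0.
  have := delta_cycle y z x (Tspan_delta v rT).
  by move<-; rewrite /D2; abel.
(* Applying ad v to delta_cycle shows that this sum is its own opposite. *)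
have cyc2 : D2 v x [l y, z] + D2 v y [l z, x] + D2 v z [l x, y] = 0.
  pose X := D2 v x [l y, z] + D2 v y [l z, x] + D2 v z [l x, y].
  (* After the symmetry [D2C], the difference of the two sides is [delta] of a Jacobi sum. *)
  have XE : X = D2 x [l y, z] v + D2 y [l z, x] v + D2 z [l x, y] v.
    rewrite /X (D2C v x) (D2C v y) (D2C v z); apply/eqP; rewrite -subr_eq0;
      apply/eqP.
    have := delta_linear v rT => dl.
    transitivity (delta ([l [l y, z], x] + [l [l z, x], y] + [l [l x, y], z]) r
      v).
      by rewrite !(lin_add dl) !D2l; abel.
    rewrite (_ : _ + _ = 0) ?(lin_zero dl) //.
    rewrite (bracketC _ x) (bracketC _ y) (bracketC [l x, y]) -!opprD.
    by rewrite bracket_jacobi oppr0.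
  have b_r a b c : [l v, delta a r [l b, c]] =
      D2 a [l b, c] v - D2 a v [l b, c] + D2 v a [l b, c].
    rewrite (bracket_delta (delta a r)).
    by rewrite (delta_sym a _ rT) D2l (D2C v _ a) (D2C _ v a).
  have := congr1 (@bracket k L v) (delta_cycle y z x rT).
  rewrite 2!bracketDr bracket0r !b_r => X2;
    apply: (mulrSn_eq0 (n := 1)) char0 _.
  rewrite -/X mulr2n {2}XE -[RHS]X2 /X -[LHS]subr0 -[X in _ - X]cyc1.
  abel.
(* Moving [r] inside two brackets costs only second-order terms. For [a = x], [b = [y, z]] their
   cyclic sums are those of [cyc1] and [cyc2]. *)
have step a b : r [l a, [l b, v]] =
    [l a, [l b, r v]] - D2 a v b *+ 2 + D2 v a b.
  rewrite r_bracket r_bracket bracketDr bracketNr (bracket_delta (delta b r)).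
  rewrite (delta_sym b [l a, v] rT) (delta_sym a [l b, v] rT) !D2l -/(D2 a b v)
    (D2C b v a) (D2C v b a).
  abel.
rewrite /T !(lin_add r_lin) !step -[RHS]addr0 -cyc2 -[RHS]subr0.
rewrite -[X in _ = _ - X](mul0rn _ 2) -cyc1.
abel.
Qed.

Lemma Tspan_comm r s v : Tspan r -> Tspan s -> r (s v) = s (r v).
Proof.
move=> rT; have r_lin := Tspan_linear rT.
elim=> [x y z|s1 s2 _ IH1 _ IH2|c s1 _ IH]; first exact: Tspan_commT.
  by rewrite (lin_add r_lin) IH1 IH2.
by rewrite (lin_scale r_lin) IH.
Qed.

(** Symmetry turns [delta b s v] into [delta v s b]; commuting brings [b] under [delta a r], where
    [a] and [b] can be exchanged. *)
Lemma delta_swap r s a b v : Tspan r -> Tspan s ->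
  delta a r (delta b s v) = delta b r (delta a s v).
Proof.
move=> rT sT; have [art brt] := (Tspan_delta a rT, Tspan_delta b rT).
rewrite (delta_sym b v sT) (Tspan_comm _ art (Tspan_delta v sT)).
rewrite (delta_sym a b rT) -(Tspan_comm _ brt (Tspan_delta v sT)).
by rewrite (delta_sym v a sT).
Qed.

End Tspan.

(** * The commutative algebra generated by commuting operators *)

Record opdata (k : fieldType) := OpData {
  opspace : lmodType k;
  opgen : (opspace -> opspace) -> Prop;
  opshift : opspace -> opspace;
  opgen_linear : forall s, opgen s -> linear s;
  opgen_comm : forall s t v, opgen s -> opgen t -> s (t v) = t (s v);
  opshift_linear : linear opshift;
  opgen_shift : forall s, opgen s ->
    opgen (fun v => opshift (s v) - s (opshift v));
  opspace_nontrivial : exists v : opspace, v != 0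
}.

Section OperatorAlgebra.
Variables (k : fieldType) (d : opdata k).
Notation V := (opspace d).
Implicit Types (h s x y z : V -> V).

Definition commutant h :=
  linear h /\ forall s v, opgen s -> h (s v) = s (h v).

(** The algebra is taken as the bicommutant of the generators among linear maps, which avoids
    handling polynomial expressions in them. *)
Definition in_opalg x :=
  linear x /\ forall h v, commutant h -> x (h v) = h (x v).

Lemma opgen_in_opalg s : opgen s -> in_opalg s.
Proof. by move=> sS; split=> [|h v [_ ->]] //; exact: opgen_linear sS. Qed.

(** The generators commute pairwise, so they lie in their own commutant and [x] commutes with them.
    This makes the bicommutant commutative. *)
Lemma in_opalg_commutant x : in_opalg x -> commutant x.
Proof.
case=> x_lin x_comm; split=> // s v sS; apply: x_comm.
by split=> [|t w tS]; [exact: opgen_linear sS | exact: opgen_comm sS tS].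
Qed.

Lemma in_opalg_scale c : in_opalg (fun v => c *: v).
Proof.
split=> [e u v|h v [h_lin _]]; last by rewrite (lin_scale h_lin).
by rewrite scalerDr !scalerA mulrC.
Qed.

Lemma in_opalg_add x y : in_opalg x -> in_opalg y -> in_opalg (fun v =>
  x v + y v).
Proof.
move=> [x_lin x_comm] [y_lin y_comm]; split=> [c u v|h v hC].
  by rewrite x_lin y_lin scalerDr addrACA.
by rewrite x_comm // y_comm // (lin_add hC.1).
Qed.

Lemma in_opalg_comp x y : in_opalg x -> in_opalg y -> in_opalg (fun v =>
  x (y v)).
Proof.
move=> [x_lin x_comm] [y_lin y_comm]; split=> [c u v|h v hC].
  by rewrite y_lin x_lin.
by rewrite y_comm // x_comm.
Qed.

Lemma in_opalg_opp x : in_opalg x -> in_opalg (fun v => - x v).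
Proof.
move=> xA; rewrite (_ : (fun v => _) = fun v => -1 *: x v).
  exact: in_opalg_comp (in_opalg_scale _) xA.
by apply: funext => v; rewrite scaleN1r.
Qed.

(** If [h] commutes with the generators, so does its commutator with [opshift], by [opgen_shift].
    Thus [x] commutes with both, and the Jacobi identity for commutators concludes. *)
Lemma in_opalg_shift x : in_opalg x ->
  in_opalg (fun v => opshift (x v) - x (opshift v)).
Proof.
have D_lin := @opshift_linear k d; have D_add := lin_add D_lin.
move=> [x_lin x_comm]; have x_add := lin_add x_lin.
split=> [c u v|h v hC]; first by rewrite !(x_lin, D_lin) scalerBr; abel.
have [h_lin h_comm] := hC; have h_add := lin_add h_lin.
have dhC : commutant (fun v => opshift (h v) - h (opshift v)).
  split=> [c u w|s w sS]; first by rewrite !(h_lin, D_lin) scalerBr; abel.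
  have s_lin := opgen_linear sS.
  have := h_comm _ w (opgen_shift sS).
  rewrite h_add (lin_opp h_lin) !(h_comm s) // => e.
  rewrite /= (lin_add s_lin) (lin_opp s_lin); apply: (eq_of_sub (esym e)); abel.
have := x_comm _ v dhC.
rewrite /= x_add (lin_opp x_lin) !(x_comm h) // h_add (lin_opp h_lin) => e.
apply: (eq_of_sub (esym e)); abel.
Qed.

Record opalg := OpAlg { opval :> V -> V; opvalP : in_opalg opval }.

Lemma opval_inj (a b : opalg) : (forall v, a v = b v) -> a = b.
Proof.
case: a b => [a aP] [b bP] /= /funext eq_ab; case: _ / eq_ab in bP *.
by congr OpAlg; apply: Prop_irrelevance.
Qed.

HB.instance Definition _ := gen_eqMixin opalg.
HB.instance Definition _ := gen_choiceMixin opalg.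

Definition op_scalar c := OpAlg (in_opalg_scale c).
Definition op_add (a b : opalg) := OpAlg (in_opalg_add (opvalP a) (opvalP b)).
Definition op_opp (a : opalg) := OpAlg (in_opalg_opp (opvalP a)).
Definition op_mul (a b : opalg) := OpAlg (in_opalg_comp (opvalP a) (opvalP b)).

Fact op_addA : associative op_add.
Proof. by move=> a b c; apply: opval_inj => v /=; rewrite addrA. Qed.
Fact op_addC : commutative op_add.
Proof. by move=> a b; apply: opval_inj => v /=; rewrite addrC. Qed.
Fact op_add0 : left_id (op_scalar 0) op_add.
Proof. by move=> a; apply: opval_inj => v /=; rewrite scale0r add0r. Qed.
Fact op_addN : left_inverse (op_scalar 0) op_opp op_add.
Proof. by move=> a; apply: opval_inj => v /=; rewrite scale0r addNr. Qed.

HB.instance Definition _ := GRing.isZmodule.Build opalg op_addA op_addC op_add0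
  op_addN.

Fact op_mulA : associative op_mul.
Proof. by move=> a b c; apply: opval_inj. Qed.
Fact op_mulC : commutative op_mul.
Proof.
move=> a b; apply: opval_inj => v /=.
by have [_ ->] := opvalP a; last exact/in_opalg_commutant/opvalP.
Qed.
Fact op_mul1 : left_id (op_scalar 1) op_mul.
Proof. by move=> a; apply: opval_inj => v /=; rewrite scale1r. Qed.
Fact op_mulDl : left_distributive op_mul op_add.
Proof. by move=> a b c; apply: opval_inj. Qed.
Fact op_one_neq0 : op_scalar 1 != 0.
Proof.
have [v v0] := opspace_nontrivial d;
  apply/eqP => /(congr1 (fun a : opalg => a v)).
by rewrite /= scale0r scale1r => /eqP; rewrite (negbTE v0).
Qed.

HB.instance Definition _ := GRing.Zmodule_isComNzRing.Build opalg
  op_mulA op_mulC op_mul1 op_mulDl op_one_neq0.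

Fact op_scalar_additive : zmod_morphism op_scalar.
Proof. by move=> c e; apply: opval_inj => v /=; rewrite scalerBl. Qed.
Fact op_scalar_multiplicative : monoid_morphism op_scalar.
Proof. by split=> [//|c e]; apply: opval_inj => v /=; rewrite scalerA. Qed.

HB.instance Definition _ := GRing.isZmodMorphism.Build k opalg op_scalar
  op_scalar_additive.
HB.instance Definition _ := GRing.isMonoidMorphism.Build k opalg op_scalar
  op_scalar_multiplicative.

Definition op_der (a : opalg) := OpAlg (in_opalg_shift (opvalP a)).

Fact op_der_additive : zmod_morphism op_der.
Proof.
move=> a b; apply: opval_inj => v /=.
rewrite (lin_add (@opshift_linear k d)) (lin_opp (@opshift_linear k d)); abel.
Qed.

HB.instance Definition _ := GRing.isZmodMorphism.Build opalg opalg op_der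
  op_der_additive.

Lemma op_derM a b : op_der (a * b) = op_der a * b + a * op_der b.
Proof.
apply: opval_inj => v /=; have [a_lin _] := opvalP a.
rewrite (lin_add a_lin) (lin_opp a_lin); abel.
Qed.

Lemma op_der_scalar c : op_der (op_scalar c) = 0.
Proof.
by apply: opval_inj => v /=;
  rewrite (lin_scale (@opshift_linear k d)) subrr scale0r.
Qed.

End OperatorAlgebra.

(** * Quotients of commutative differential rings *)

Record quotdata (k : fieldType) := QuotData {
  qring : comNzRingType;
  qconst : {rmorphism k -> qring};
  qder : {additive qring -> qring};
  qideal : qring -> Prop;
  qder_leibniz : forall a b, qder (a * b) = qder a * b + a * qder b;
  qder_const : forall c, qder (qconst c) = 0;
  qideal0 : qideal 0;
  qidealD : forall a b, qideal a -> qideal b -> qideal (a + b);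
  qidealM : forall a b, qideal b -> qideal (a * b);
  qideal_der : forall a, qideal a -> qideal (qder a)
}.

Section Quotient.
Variables (k : fieldType) (d : quotdata k).
Notation M := (qring d).
Notation I := (@qideal k d).
Implicit Types a b : M.

(** Classical logic turns membership in the ideal into the boolean relation on which quotient types
    are built. *)
Definition qrel a b : bool := `[< I (a - b) >].

Fact qidealN a : I a -> I (- a).
Proof. by move=> Ia; rewrite -mulN1r; apply: qidealM. Qed.

Fact qrel_equiv : equiv_class_of qrel.
Proof.
split=> [a|a b|b a c]; rewrite /qrel.
- by apply/asboolP; rewrite subrr; apply: qideal0.
- by apply: asbool_equiv_eq; split=> /qidealN; rewrite opprB.
- move=> /asboolP Iab /asboolP Ibc; apply/asboolP.
  by rewrite -[a](subrK b) -addrA; apply: qidealD.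
Qed.

Canonical qrel_equivRel := EquivRelPack qrel_equiv.

Definition diffquot := {eq_quot qrel}.
HB.instance Definition _ := Choice.on diffquot.

Definition qpi (a : M) : diffquot := \pi_({eq_quot qrel}) a.
Definition qrepr (q : diffquot) : M := repr (q : {eq_quot qrel}).

Lemma qpiE a b : qpi a = qpi b <-> I (a - b).
Proof. by split=> [/eqmodP/asboolP|Iab] //; apply/eqmodP/asboolP. Qed.

Lemma qreprK : cancel qrepr qpi.
Proof. exact: reprK. Qed.

Lemma qrepr_pi a : I (qrepr (qpi a) - a).
Proof. by apply/qpiE; rewrite qreprK. Qed.

Definition q_add p q := qpi (qrepr p + qrepr q).
Definition q_opp p := qpi (- qrepr p).
Definition q_mul p q := qpi (qrepr p * qrepr q).
Definition q_scale c p := qpi (qconst d c * qrepr p).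
Definition q_der p := qpi (qder d (qrepr p)).

Lemma qpiD a b : q_add (qpi a) (qpi b) = qpi (a + b).
Proof. by apply/qpiE; rewrite opprD addrACA; apply: qidealD;
  apply: qrepr_pi. Qed.

Lemma qpiN a : q_opp (qpi a) = qpi (- a).
Proof. by apply/qpiE; rewrite -opprD; apply/qidealN/qrepr_pi. Qed.

Lemma qpiM a b : q_mul (qpi a) (qpi b) = qpi (a * b).
Proof.
apply/qpiE; set a' := qrepr _; set b' := qrepr _.
rewrite (_ : _ - _ = b' * (a' - a) + a * (b' - b)); last by ring.
by apply: qidealD; apply: qidealM; apply: qrepr_pi.
Qed.

Lemma qpiZ c a : q_scale c (qpi a) = qpi (qconst d c * a).
Proof. by apply/qpiE; rewrite -mulrBr; apply/qidealM/qrepr_pi. Qed.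

Lemma qpi_der a : q_der (qpi a) = qpi (qder d a).
Proof. by apply/qpiE; rewrite -raddfB; apply/qideal_der/qrepr_pi. Qed.

Definition qpi_simp := (qpiD, qpiN, qpiM, qpiZ, qpi_der).

Fact q_addA : associative q_add.
Proof. by move=> p q r; rewrite -[p]qreprK -[q]qreprK -[r]qreprK !qpi_simp
  addrA. Qed.
Fact q_addC : commutative q_add.
Proof. by move=> p q; rewrite /q_add addrC. Qed.
Fact q_add0 : left_id (qpi 0) q_add.
Proof. by move=> p; rewrite -[p]qreprK !qpi_simp add0r. Qed.
Fact q_addN : left_inverse (qpi 0) q_opp q_add.
Proof. by move=> p; rewrite -[p]qreprK !qpi_simp addNr. Qed.

HB.instance Definition _ := GRing.isZmodule.Build diffquot q_addA q_addC q_add0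
  q_addN.

Fact q_scaleA c e p : q_scale c (q_scale e p) = q_scale (c * e) p.
Proof. by rewrite -[p]qreprK !qpi_simp rmorphM mulrA. Qed.
Fact q_scale1 : left_id 1 q_scale.
Proof. by move=> p; rewrite -[p]qreprK !qpi_simp rmorph1 mul1r. Qed.
Fact q_scaleDr : right_distributive q_scale +%R.
Proof.
move=> c p q; rewrite -[p]qreprK -[q]qreprK.
by rewrite /GRing.add /= !qpi_simp mulrDr.
Qed.
Fact q_scaleDl p : {morph q_scale^~ p : c e / c + e}.
Proof.
by move=> c e; rewrite -[p]qreprK [in RHS]/GRing.add /= !qpi_simp rmorphD
  mulrDl.
Qed.

HB.instance Definition _ := GRing.Zmodule_isLmodule.Build k diffquot
  q_scaleA q_scale1 q_scaleDr q_scaleDl.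

Lemma qpi_add a b : qpi (a + b) = qpi a + qpi b.
Proof. by rewrite -qpiD. Qed.
Lemma qpi_opp a : qpi (- a) = - qpi a.
Proof. by rewrite -qpiN. Qed.
Lemma qpi_scale c a : qpi (qconst d c * a) = c *: qpi a.
Proof. by rewrite -qpiZ. Qed.

Fact q_mulC : commutative q_mul.
Proof. by move=> p q; rewrite /q_mul mulrC. Qed.
Fact q_mulA : associative q_mul.
Proof. by move=> p q r; rewrite -[p]qreprK -[q]qreprK -[r]qreprK !qpi_simp
  mulrA. Qed.
Fact q_mulDr p : linear (q_mul p).
Proof.
move=> c q r; rewrite -[p]qreprK -[q]qreprK -[r]qreprK.
rewrite -qpi_scale -qpi_add !qpiM -qpi_scale -qpi_add; congr qpi; ring.
Qed.
Fact q_mul_bilinear : bilinear_for *:%R *:%R q_mul.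
Proof.
by split=> [q c p r | p c q r];
  rewrite /= ?[q_mul _ q]q_mulC q_mulDr // !(q_mulC q).
Qed.
Fact q_der_linear : linear q_der.
Proof.
move=> c p q; rewrite -[p]qreprK -[q]qreprK -qpi_scale -qpi_add !qpi_der.
by rewrite raddfD /= qder_leibniz qder_const mul0r add0r qpi_add qpi_scale.
Qed.
Fact q_der_leibniz p q : q_der (q_mul p q) = q_mul (q_der p) q + q_mul p (q_der
  q).
Proof.
by rewrite -[p]qreprK -[q]qreprK !qpi_simp -qpi_add qder_leibniz.
Qed.

HB.instance Definition _ := isDiffAlgebra.Build k diffquot
  q_mul_bilinear q_mulA q_mulC q_der_linear q_der_leibniz.

Lemma qpi_mul a b : qpi (a * b) = dmul (qpi a) (qpi b).
Proof. by rewrite -qpiM. Qed.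
Lemma qpi_qder a : qpi (qder d a) = der (qpi a).
Proof. by rewrite -qpi_der. Qed.
Lemma qpi_eq0 a : qpi a = 0 <-> I a.
Proof. by rewrite -[X in I X]subr0; apply: qpiE. Qed.

End Quotient.

(** * Prime quotients *)

Section PrimeQuotient.
Variables (k : fieldType) (L : lieAlgType k) (M : comNzRingType).
Variables (const : {rmorphism k -> M}) (D : {additive M -> M}) (f : L -> M).
Hypothesis D_leibniz : forall a b, D (a * b) = D a * b + a * D b.
Hypothesis D_const : forall c, D (const c) = 0.
Hypothesis f_linear : forall c x y, f (c *: x + y) = const c * f x + f y.

Definition is_diff_ideal (I : set M) : Prop :=
  [/\ I 0, forall a b, I a -> I b -> I (a + b), forall a b, I b -> I (a * b)
    & forall a, I a -> I (D a)].

Definition lie_relations (I : set M) : Prop :=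
  forall x y, I (f x * D (f y) - D (f x) * f y - f (bracket x y)).

Definition avoids (I : set M) : Prop := forall x, I (f x) -> x = 0.

(** These are the ideals modulo which [f] becomes an injective Lie morphism. *)
Definition good I := [/\ is_diff_ideal I, lie_relations I & avoids I].

Lemma maximal_good (J : set M) : good J ->
  exists I, good I /\ forall K, (I `<=` K)%classic -> good K -> (K `<=`
    I)%classic.
Proof.
move=> goodJ; pose P (X : set M) := X = set0 \/ good X.
have [|I [PI maxI]] := @Zorn_bigcup M P.
  move=> F FP Ftot.
  have [[X0 [F0 good0]]|noX] := pselect (exists X, F X /\ good X); last first.
    left; rewrite -subset0 => m [X FX Xm]; case: (FP X FX) => [X0|gX].
      by rewrite -X0.
    by case: noX; exists X.
  have goodX X m : F X -> X m -> good X.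
    by move=> FX Xm; case: (FP X FX) => // eX; rewrite eX in Xm.
  have inF X m : F X -> X m -> (\bigcup_(Y in F) Y)%classic m by exists X.
  right; split; first split.
  - by have [[? _ _ _] _ _] := good0; apply: inF F0 _.
  - move=> a b [X FX Xa] [Y FY Yb].
    case: (Ftot X Y FX FY) => [XY|YX].
      by have [[_ addI _ _] _ _] := goodX _ _ FY Yb; apply: inF FY _;
        apply: addI (XY _ Xa) Yb.
    by have [[_ addI _ _] _ _] := goodX _ _ FX Xa; apply: inF FX _;
      apply: addI Xa (YX _ Yb).
  - by move=> a b [X FX Xb]; have [[_ _ mulI _] _ _] := goodX _ _ FX Xb;
      apply: inF FX _; apply: mulI.
  - by move=> a [X FX Xa]; have [[_ _ _ derI] _ _] := goodX _ _ FX Xa;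
      apply: inF FX _; apply: derI.
  - by move=> x y; have [_ relI _] := good0; apply: inF F0 _; apply: relI.
  - by move=> x [X FX Xx]; have [_ _ avI] := goodX _ _ FX Xx; apply: avI.
have goodI : good I.
  case: PI => // I0; rewrite I0 in maxI; case: (maxI J); last by right.
  split=> [m []|sub]; have [[J0 _ _ _] _ _] := goodJ; exact: sub _ J0.
exists I; split=> // K IK goodK; apply: contrapT => nKI.
by apply: (maxI K); [split | right].
Qed.

(** By maximality every nonzero differential ideal of the quotient pulls back to a nonzero ideal of
    [L]. If two of them had product zero, the bracket formula of [Diff] would make their pullbacks
    commute. *)
Theorem prime_quotient (J : set M) : lie_prime L -> good J ->
  exists (A : diffAlgType k) (g : L -> Diff A),
    [/\ diff_prime A, lie_morphism g & injective g].
Proof.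
move=> primeL /maximal_good[I [[[I0 addI mulI derI] relI avI] maxI]].
pose d := QuotData D_leibniz D_const I0 addI mulI derI.
pose g (x : L) : Diff (diffquot d) := @qpi k d (f x).
have g_eq0 x : g x = 0 -> x = 0 by move=> /qpi_eq0 /avI.
have g_linear : linear g.
  by move=> c x y; rewrite /g f_linear (@qpi_add k d) (@qpi_scale k d).
have brE (p q : Diff (diffquot d)) :
    bracket p q = dmul p (der q : diffquot d) - dmul (der p : diffquot d) q by
      [].
have g_morph : {morph g : x y / bracket x y}.
  move=> x y; rewrite brE /g -!(@qpi_qder k d) -!(@qpi_mul k d).
  by rewrite -(@qpi_opp k d) -(@qpi_add k d); apply/esym/qpiE/relI.
have g_inj : injective g.
  move=> x y e; apply/eqP; rewrite -subr_eq0; apply/eqP/g_eq0.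
  by rewrite addrC -scaleN1r g_linear e scaleN1r addNr.
exists (diffquot d), g; split=> //.
have pi0 m : I m -> @qpi k d m = 0 by move=> Im; apply/qpi_eq0.
have meets (K : diffquot d -> Prop) : diff_ideal K -> nonzero K ->
    ideal (@bracket k L) (fun x => K (g x)) /\ nonzero (fun x => K (g x)).
  move=> [[[K0 linK] mulK] derK] [q Kq q_neq0].
  have addK a b : K a -> K b -> K (a + b).
    by move=> Ka Kb; have := linK 1 _ _ Ka Kb; rewrite scale1r.
  have oppK a : K a -> K (- a).
    by move=> Ka; have := linK (-1) _ _ Ka K0; rewrite scaleN1r addr0.
  have brK x y : K (g x) -> K (g (bracket x y)).
    move=> Kx; rewrite g_morph brE; apply: addK; last apply: oppK.
      by have [_ ?] := mulK (der (g y)) _ Kx.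
    by have [_ ?] := mulK (g y) _ (derK _ Kx).
  split.
    split; first by rewrite /subspace (lin_zero g_linear);
      split=> // c u v Ku Kv; rewrite g_linear; apply: linK.
    move=> a x Kx; split; last exact: brK.
    by rewrite bracketC (lin_opp g_linear); apply/oppK/brK.
  apply: contrapT => noK; apply: q_neq0.
  rewrite -[q](@qreprK k d); apply/qpi_eq0.
  have [m qm] : exists m, q = @qpi k d m by exists (qrepr q); rewrite qreprK.
  (* If [K] met the image of [L] only in [0], its preimage would be good, hence contained in [I],
     and [q] would vanish. *)
  apply: (maxI (fun m => K (@qpi k d m))); last by rewrite qreprK.
    by move=> a Ia; rewrite pi0.
  split; first split.
  - by rewrite pi0.
  - by move=> a b Ka Kb; rewrite (@qpi_add k d); apply: addK.
  - by move=> a b Kb; rewrite (@qpi_mul k d); have [] := mulK (@qpi k d a) _ Kb.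
  - by move=> a Ka; rewrite (@qpi_qder k d); apply: derK.
  - by move=> x y; rewrite pi0 //; apply: relI.
  - by move=> x Kx; apply: contrapT => x0; apply: noK; exists x.
move=> K1 K2 dK1 nK1 dK2 nK2; apply: contrapT => prod0.
have [id1 nz1] := meets K1 dK1 nK1; have [id2 nz2] := meets K2 dK2 nK2.
have K12 a b : K1 a -> K2 b -> dmul a b = 0.
  move=> Ka Kb; apply: contrapT => ab0; apply: prod0; exists (dmul a b) => //.
  by exists 1%N, (fun=> a), (fun=> b); split=> //; rewrite big_ord1.
have [x [n [y [z [Ky Kz xE]]]] x0] := primeL _ _ id1 nz1 id2 nz2.
apply: x0; apply: g_eq0; rewrite xE.
have g_sum : g (\sum_(i < n) bracket (y i) (z i)) = \sum_(i < n) g (bracket (y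
  i) (z i)).
  by apply: (big_morph g); [exact: lin_add | exact: lin_zero].
rewrite g_sum big1 // => i _; rewrite g_morph brE.
by rewrite !K12 ?subr0 //; [exact: dK1.2 (Ky i) | exact: dK2.2 (Kz i)].
Qed.

End PrimeQuotient.

(** * Lie algebras with enough points *)

Section Points.
Variables (k : fieldType) (L : lieAlgType k) (W : lmodType k).
Implicit Types (a b x y z : L) (w : W).
Notation "[ 'l' x , y ]" := (@bracket k L x y) (format "[ 'l'  x ,  y ]").

(* The ratio xi a / xi base plays the role of the coefficient of a at a point of
   the curve on which L acts by vector fields. *)
Record point := Point {
  xi :> L -> W -> W;
  base : L;
  xi_linearl : forall w, linear (fun a => xi a w);
  xi_linearr : forall a, linear (xi a);
  xi_comm : forall a b w, xi a (xi b w) = xi b (xi a w);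
  xi_cycle : forall x y z w,
    xi x (xi [l y, z] w) + xi y (xi [l z, x] w) + xi z (xi [l x, y] w) = 0
}.

(* The n-th derivative at 0 of the product of w with the Taylor series of xi a
   along the flow of base p. *)
Fixpoint jet (p : point) (n : nat) (a : L) (w : nat -> W) : W :=
  if n is n'.+1 then jet p n' [l base p, a] w + jet p n' a (fun i => w i.+1)
  else p a (w 0%N).

Section Jet.
Variable p : point.

Lemma jet_linearl n (w : nat -> W) : linear (fun a => jet p n a w).
Proof.
elim: n w => [|n IH] w c a b /=; first exact: xi_linearl.
rewrite bracketDr bracketZr (IH w) (IH (fun i => w i.+1)) scalerDr; abel.
Qed.

Lemma jet_linearr n a c (v w : nat -> W) :
  jet p n a (fun i => c *: v i + w i) = c *: jet p n a v + jet p n a w.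
Proof.
elim: n a v w => [|n IH] a v w /=; first exact: xi_linearr.
rewrite IH (IH a (fun i => v i.+1)) scalerDr; abel.
Qed.

Lemma jetD n a (v w : nat -> W) :
  jet p n a (fun i => v i + w i) = jet p n a v + jet p n a w.
Proof.
rewrite -[X in _ = X + _]scale1r -jet_linearr; congr jet.
by apply: funext => i; rewrite scale1r.
Qed.

Lemma jet_comm n a b (w : nat -> W) :
  jet p n a (fun i => jet p i b w) = jet p n b (fun i => jet p i a w).
Proof.
elim: n a b w => [|n IH] a b w /=; first exact: xi_comm.
rewrite !jetD IH [X in _ + (X + _)]IH [X in _ + (_ + X)]IH; abel.
Qed.

Lemma jet_cycle n x y z (w : nat -> W) :
  jet p n x (fun i => jet p i [l y, z] w) + jet p n y (fun i =>
    jet p i [l z, x] w)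
    + jet p n z (fun i => jet p i [l x, y] w) = 0.
Proof.
elim: n x y z w => [|n IH] x y z w /=; first exact: xi_cycle.
have br a b : (fun i => jet p i [l base p, [l a, b]] w) =
    fun i => jet p i [l [l base p, a], b] w + jet p i [l a, [l base p, b]] w.
  apply: funext => i; rewrite -(lin_add (jet_linearl i w)); congr (jet _ _ _ _).
  by rewrite bracketA subrK.
rewrite !jetD !br !jetD.
(* One derivative along the base yields four instances of the identity: it falls on [x], on [y], on
   [z] or on [w]. *)
have IH2 := congr2 +%R (IH [l base p, x] y z w) (IH x [l base p, y] z w).
have IH4 := congr2 +%R (IH x y [l base p, z] w) (IH x y z (fun i => w i.+1)).
have := congr2 +%R IH2 IH4; rewrite !addr0 => IH_sum.
apply: (eq_of_sub IH_sum); abel.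
Qed.

(** This is [jet_cycle] with the base as one of the three elements. Writing [c] for the base, it
    says that the Wronskian of [xi x] and [xi y] is [xi c] times [xi [x, y]]. *)
Lemma jet_base n x y (w : nat -> W) :
  jet p n x (fun i => jet p i [l base p, y] w)
    - jet p n [l base p, x] (fun i => jet p i y w) =
  jet p n (base p) (fun i => jet p i [l x, y] w).
Proof.
have opp m (v : nat -> W) a : jet p m a (fun i => - v i) = - jet p m a v.
  apply/eqP; rewrite -addr_eq0 -jetD; apply/eqP.
  rewrite -[RHS](subrr (jet p m a v)) -scaleN1r -[X in _ = X + _]scale1r.
  rewrite (_ : (fun i => _) = fun i => -1 *: v i + v i) ?jet_linearr ?scaleN1r.
    by rewrite scale1r addrC.
  by apply: funext => i; rewrite scaleN1r.
have := jet_cycle n (base p) x y w; rewrite (jet_comm n y).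
rewrite (bracketC y) (_ : (fun i => jet p i (- _) w) = fun i =>
  - jet p i [l base p, y] w).
  by rewrite opp => e; apply: (eq_of_sub (esym e)); abel.
by apply: funext => i; apply: lin_opp (jet_linearl i w) _.
Qed.

End Jet.

Notation V := (point -> nat -> W).

(** The element may vary with the point, so that the family of all bases also defines one
    operator. *)
Definition jet_op (alpha : point -> L) (v : V) : V :=
  fun p n => jet p n (alpha p) (v p).
Definition shift (v : V) : V := fun p n => v p n.+1.
Definition is_jet_op (s : V -> V) : Prop := exists alpha, s = jet_op alpha.

Fact jet_op_linear s : is_jet_op s -> linear s.
Proof.
case=> alpha -> c u v; apply: funext => p; apply: funext => n.
exact: jet_linearr.
Qed.

Fact jet_op_comm s t v : is_jet_op s -> is_jet_op t -> s (t v) = t (s v).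
Proof.
case=> alpha -> [beta ->]; apply: funext => p; apply: funext => n.
exact: jet_comm.
Qed.

Fact shift_linear : linear shift. Proof. by []. Qed.

Lemma jet_op_shift alpha v :
  shift (jet_op alpha v) - jet_op alpha (shift v) =
  jet_op (fun p => [l base p, alpha p]) v.
Proof. by apply: funext => p; apply: funext => n; apply: addrK. Qed.

Fact is_jet_op_shift s :
  is_jet_op s -> is_jet_op (fun v => shift (s v) - s (shift v)).
Proof.
case=> alpha ->; exists (fun p => [l base p, alpha p]).
by apply: funext => v; apply: jet_op_shift.
Qed.

Hypothesis enough_points : forall a m, a <> 0 ->
  exists (p : point) w, iter m (p (base p)) (p a w) <> 0.

Theorem embedding : lie_prime L -> (exists a : L, a <> 0) ->
  exists (A : diffAlgType k) (g : L -> Diff A),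
    [/\ diff_prime A, lie_morphism g & injective g].
Proof.
move=> primeL [a0 a0_neq0].
have V_nontrivial : exists v : V, v != 0.
  have [p [w pw]] := enough_points 0 a0_neq0; exists (fun _ _ => w).
  apply/eqP => /(congr1 (fun v : V => v p 0%N)) /= w0; apply: pw.
  by rewrite /= w0; apply: lin_zero (xi_linearr p a0).
pose d := OpData jet_op_linear jet_op_comm shift_linear is_jet_op_shift
  V_nontrivial.
have F_in alpha : in_opalg (d := d) (jet_op alpha).
  by apply: opgen_in_opalg; exists alpha.
pose F alpha : opalg d := OpAlg (F_in alpha).
(* The common denominator; its derivative vanishes because [[base p, base p] = 0]. *)
pose u := F (fun p => base p).
pose G (a : L) := F (fun=> a).
have F_der alpha : op_der (F alpha) = F (fun p => [l base p, alpha p]).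
  by apply: opval_inj => v; apply: jet_op_shift.
have u_der : op_der u = 0.
  rewrite F_der; apply: opval_inj => v; rewrite /= scale0r.
  apply: funext => p; apply: funext => n; rewrite /jet_op bracket_alt.
  exact: lin_zero (jet_linearl p n (v p)).
have G_rel x y : G x * op_der (G y) - op_der (G x) * G y = u * G [l x, y].
  rewrite !F_der; apply: opval_inj => v; apply: funext => p; apply: funext => n.
  exact: jet_base.
pose const : {rmorphism k -> {poly opalg d}} := (@polyC (opalg d) \o @op_scalar
  k d)%FUN.
pose D : {additive {poly opalg d} -> {poly opalg d}} := map_poly (@op_der k d).
have DE (q : {poly opalg d}) i : (D q)`_i = op_der q`_i.
  by rewrite coef_map_id0 // raddf0.
have D_leibniz p q : D (p * q) = D p * q + p * D q.
  apply/polyP => i; rewrite DE coefD !coefM raddf_sum -big_split /=.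
  by apply: eq_bigr => j _; rewrite op_derM !DE.
have D_C (b : opalg d) : D b%:P = (op_der b)%:P.
  by apply/polyP => i; rewrite DE !coefC; case: ifP => // _; rewrite raddf0.
have D_X : D 'X = 0.
  apply/polyP => i; rewrite DE coefX coef0 -(rmorph_nat (@op_scalar k d)).
  exact: op_der_scalar.
have D_const c : D (const c) = 0.
  by rewrite [const c]/= D_C op_der_scalar.
pose f (a : L) : {poly opalg d} := (G a)%:P * 'X.
have f_linear c x y : f (c *: x + y) = const c * f x + f y.
  rewrite /f mulrA -mulrDl -polyCM -polyCD; congr (_%:P * _).
  apply: opval_inj => v; apply: funext => p; apply: funext => n.
  exact: jet_linearl.
(* Modulo [e] the indeterminate is an inverse of [u]: this is the localization at [u], and [f a] is
   the fraction [G a / u]. *)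
pose e : {poly opalg d} := u%:P * 'X - 1.
have D_e : D e = 0.
  by rewrite /e raddfB D_leibniz D_C u_der D_X mulr0 mul0r addr0 -polyC1 D_C
    -(rmorph1 (@op_scalar k d)) op_der_scalar subrr.
apply: (@prime_quotient k L _ const D f D_leibniz D_const f_linear (fun m =>
  exists q, m = e * q)) => //.
split; first split.
- by exists 0; rewrite mulr0.
- by move=> _ _ [q ->] [r ->]; exists (q + r); rewrite mulrDr.
- by move=> b _ [q ->]; exists (b * q); rewrite mulrCA.
- by move=> _ [q ->]; exists (D q); rewrite D_leibniz D_e mul0r add0r.
- move=> x y; exists ((G [l x, y])%:P * 'X).
  rewrite /f !D_leibniz D_X !mulr0 !addr0 !D_C.
  transitivity ((G x * op_der (G y) - op_der (G x) * G y)%:P * 'X * 'X - (G [l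
    x, y])%:P * 'X).
    by rewrite polyCB !polyCM; ring.
  by rewrite G_rel polyCM /e; ring.
(* Comparing coefficients in [f a = e * q] from the bottom gives those of [q] as [- u ^+ i * G a].
   As [q] is a polynomial, [u ^+ size q] kills [G a], against a point chosen for the exponent
   [size q]. *)
- move=> a [q qE]; apply: contrapT => a_neq0.
  have coefE i : (f a)`_i.+1 = u * q`_i - q`_i.+1.
    by rewrite qE /e mulrBl mul1r -mulrA coefB coefCM coefXM.
  have q0 : q`_0 = 0.
    have e0 : (e * q)`_0 = - q`_0.
      by rewrite /e mulrBl mul1r -mulrA coefB coefCM coefXM mulr0 sub0r.
    by apply/eqP; rewrite -oppr_eq0 -e0 -qE /f coefCM coefX mulr0.
  have qS i : q`_i.+1 = - (u ^+ i * G a).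
    elim: i => [|i IH].
      have := coefE 0%N; rewrite q0 mulr0 sub0r coefCM coefX mulr1 expr0 mul1r
        => ->.
      by rewrite opprK.
    have := coefE i.+1; rewrite coefCM coefX mulr0 IH mulrN exprS -mulrA =>
      /eqP.
    by rewrite eq_sym subr_eq0 => /eqP.
  have uG : u ^+ size q * G a = 0.
    have := qS (size q); rewrite nth_default // => /eqP.
    by rewrite eq_sym oppr_eq0 => /eqP.
  have [p [w pw]] := enough_points (size q) a_neq0; apply: pw.
  (* In degree 0 a jet operator is [xi] itself. *)
  have uv n (v : V) : (u ^+ n : opalg d) v p 0%N = iter n (p (base p)) (v p
    0%N).
    elim: n => [|n IH]; first by rewrite expr0 /= scale1r.
    by rewrite exprS /= -IH.
  have := congr1 (fun b : opalg d => b (fun _ _ => w) p 0%N) uG.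
  by rewrite /= uv => ->; rewrite scale0r.
Qed.
End Points.

(** * Enough points on a prime Lie algebra *)

Section Polarization.
Variables (k : fieldType) (V : lmodType k).
Hypothesis char0 : [pchar k] =i pred0.

(** Subtracting [2 ^ n] times the value at [t] from the value at [2 * t] removes the top term and
    multiplies the others by [2 ^ i - 2 ^ n], nonzero in characteristic zero. *)
Lemma poly_coef_eq0 n (c : nat -> V) :
  (forall t : k, \sum_(i < n) t ^+ i *: c i = 0) -> forall i, (i < n)%N -> c i
    = 0.
Proof.
elim: n c => [//|n IH] c c0.
have c_lt i : (i < n)%N -> c i = 0.
  move=> lt_in; have /eqP : (2%:R ^+ i - 2%:R ^+ n) *: c i = 0.
    apply: (IH (fun i => (2%:R ^+ i - 2%:R ^+ n) *: c i)) lt_in => t.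
    have := congr2 (fun u v => u - 2%:R ^+ n *: v) (c0 (2%:R * t)) (c0 t).
    rewrite scaler0 subr0 => e;
      rewrite -[RHS]e !big_ord_recr /= scalerDr !scalerA exprMn.
    rewrite opprD addrACA subrr addr0 scaler_sumr -sumrB; apply: eq_bigr => j _.
    by rewrite exprMn !scalerA -scalerBl mulrBr [t ^+ j * _]mulrC [t ^+ j *
      _]mulrC.
  rewrite scaler_eq0 => /orP[|/eqP //];
    rewrite -opprB oppr_eq0 -!natrX -natrB ?leq_exp2l ?(ltnW lt_in) //.
  by have /pcharf0P-> := char0; rewrite subn_eq0 leq_exp2l // leqNgt lt_in.
move=> i; rewrite ltnS leq_eqVlt => /orP[/eqP->|]; last exact: c_lt.
have := c0 1; rewrite big_ord_recr /= big1 => [|j _];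
  last by rewrite c_lt ?scaler0.
by rewrite add0r expr1n scale1r.
Qed.

Variables A B : V -> V.
Hypotheses (A_lin : linear A) (B_lin : linear B).
Hypothesis AB_comm : forall v, A (B v) = B (A v).

(** The coefficient of [t] is [A^m w + m A^(m-1) B v]; since [B v = A w], its terms merge into one
    multiple of [A^m w]. *)
Lemma iter_polynomial m v w : B v = A w ->
  exists c : nat -> V,
    [/\ forall t, iter m (fun u => A u + t *: B u) (v + t *: w) =
          \sum_(i < m.+2) t ^+ i *: c i,
        c 0%N = iter m A v & c 1%N = iter m A w *+ m.+1].
Proof.
move=> BvAw; elim: m => [|m [c [cE c0 c1]]].
  exists (fun i => if i is 0%N then v else w); split=> // t.
  by rewrite !big_ord_recl big_ord0 /= addr0 expr0 scale1r.
(* The values of [c] from [m.+2] on are unspecified, so the new top coefficient is set to zero by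
   hand. *)
have [cA [cA_lt cA_max]] : exists cA : nat -> V,
    (forall i, (i < m.+2)%N -> cA i = A (c i)) /\ cA m.+2 = 0.
  exists (fun i => if (i < m.+2)%N then A (c i) else 0).
  by split=> [i ->|] //; rewrite ltnn.
exists (fun i => cA i + if i is j.+1 then B (c j) else 0); split=> [t||].
- rewrite iterS cE; under [RHS]eq_bigr => i _ do rewrite scalerDr.
  rewrite big_split /=; congr (_ + _).
    rewrite [RHS]big_ord_recr /= cA_max scaler0 addr0.
    rewrite (big_morph A (lin_add A_lin) (lin_zero A_lin)).
    by apply: eq_bigr => i _; rewrite (lin_scale A_lin) cA_lt.
  rewrite [RHS]big_ord_recl /= scaler0 add0r.
  rewrite (big_morph B (lin_add B_lin) (lin_zero B_lin)) scaler_sumr.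
  by apply: eq_bigr => i _; rewrite (lin_scale B_lin) scalerA exprS.
- by rewrite addr0 cA_lt // c0.
rewrite cA_lt // c1 c0.
have BA : B (iter m A v) = A (iter m A w).
  by elim: m {c cE c0 c1 cA cA_lt cA_max} => //= m IHm; rewrite -AB_comm IHm.
have A_muln j u : A (u *+ j) = A u *+ j.
  by elim: j => [|j IHj]; rewrite ?(lin_zero A_lin) // !mulrSr (lin_add A_lin)
    IHj.
by rewrite BA A_muln [in RHS]mulrSr.
Qed.

Lemma iter_polarize m v w : B v = A w ->
  (forall t, iter m (fun u => A u + t *: B u) (v + t *: w) = 0) -> iter m A w =
    0.
Proof.
move=> /(iter_polynomial m)[c [cE _ c1]] c_eq0;
  apply: (mulrSn_eq0 (n := m)) char0 _.
by rewrite -c1; apply: (@poly_coef_eq0 m.+2) => // t; rewrite -cE.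
Qed.

End Polarization.

(** * Primeness tested on spanning sets *)

Inductive lspan (k : fieldType) (L : lmodType k) (P : L -> Prop) : L -> Prop :=
  | lspan0 : lspan P 0
  | lspanD c x v : P x -> lspan P v -> lspan P (c *: x + v).

Lemma lspan_lin (k : fieldType) (L : lmodType k) (P : L -> Prop) c u v :
  lspan P u -> lspan P v -> lspan P (c *: u + v).
Proof.
move=> Pu Pv; elim: Pu => [|e x w Px _ IH]; first by rewrite scaler0 add0r.
by rewrite scalerDr scalerA -addrA; apply: lspanD.
Qed.

Lemma lspan_mem (k : fieldType) (L : lmodType k) (P : L -> Prop) x : P x ->
  lspan P x.
Proof. by move=> Px; rewrite -[x]scale1r -[_ *: _]addr0;
  apply: lspanD Px (lspan0 _). Qed.

Section PrimeLie.
Variables (k : fieldType) (L : lieAlgType k).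
Hypothesis primeL : lie_prime L.
Notation "[ 'l' x , y ]" := (@bracket k L x y) (format "[ 'l'  x ,  y ]").
Implicit Types (P Q : L -> Prop).

Lemma lspan_ideal P :
  (forall a x, P x -> lspan P [l a, x]) -> ideal (@bracket k L) (lspan P).
Proof.
move=> P_br; split; first by split=> [|c u v];
  [exact: lspan0 | exact: lspan_lin].
move=> a x Px; have ax : lspan P [l a, x].
  elim: Px => [|c y v Py _ IH]; first by rewrite bracket0r; apply: lspan0.
  by rewrite bracketDr bracketZr; apply: lspan_lin (P_br _ _ Py) IH.
split=> //; rewrite bracketC -scaleN1r -[_ *: _]addr0.
exact: lspan_lin ax (lspan0 _).
Qed.

(** The spans are ideals and their brackets vanish by bilinearity, so primeness applies. *)
Lemma prime_span P Q :
  (forall a x, P x -> lspan P [l a, x]) -> (forall a x, Q x -> lspan Q [l a,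
    x]) ->
  (forall x y, P x -> Q y -> [l x, y] = 0) ->
  (exists2 y, Q y & y <> 0) -> forall x, P x -> x = 0.
Proof.
move=> P_br Q_br PQ0 [y Qy y0] x Px; apply: contrapT => x0.
have [z [n [u [v [Pu Qv zE]]]] z0] := primeL (lspan_ideal P_br)
  (ex_intro2 _ _ x (lspan_mem Px) x0) (lspan_ideal Q_br)
  (ex_intro2 _ _ y (lspan_mem Qy) y0).
apply: z0; rewrite zE big1 // => i _.
elim: (Pu i) => [|c a w Pa _ IH]; first by rewrite bracket0l.
rewrite bracketDl bracketZl IH addr0.
elim: (Qv i) => [|e b t Qb _ IHb]; first by rewrite bracket0r scaler0.
by rewrite bracketDr bracketZr PQ0 // scaler0 add0r.
Qed.

End PrimeLie.

(** * Points when some [delta c r] is nonzero *)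

Section NonCentralCase.
Variables (k : fieldType) (L : lieAlgType k).
Hypotheses (char0 : [pchar k] =i pred0) (primeL : lie_prime L) (st5 : St5 L).
Notation "[ 'l' x , y ]" := (@bracket k L x y) (format "[ 'l'  x ,  y ]").
Implicit Types (a b c v w x y z : L) (r s : L -> L).
Hypothesis delta_neq0 : exists c r v, Tspan r /\ delta c r v <> 0.

Let delta_lin c r : Tspan r -> linear (delta c r).
Proof. by move=> rT; apply: Tspan_linear; apply: Tspan_delta. Qed.

(** The common kernel of all [delta c r] and the span of their values are ideals. They commute by
    [bracket_delta] and the symmetry of [delta], and the second is nonzero. *)
Lemma annihilator_eq0 x : (forall c r, Tspan r -> delta c r x = 0) -> x = 0.
Proof.
move: x; have [c0 [r0 [v0 [r0T v0_neq0]]]] := delta_neq0.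
have delta2_x x a c r : (forall c r, Tspan r -> delta c r x = 0) -> Tspan r ->
    delta a (delta c r) x = 0.
  move=> x0 rT; have := delta_bracket a c x rT.
  by rewrite x0 // (x0 c) ?subr0 //; apply: Tspan_delta.
have delta_x x a c r : (forall c r, Tspan r -> delta c r x = 0) -> Tspan r ->
    delta c r [l a, x] = 0.
  move=> x0 rT; have := delta2_x x a c r x0 rT.
  rewrite {1}/delta (x0 c r rT) bracket0r sub0r => /eqP.
  by rewrite oppr_eq0 => /eqP.
apply: (prime_span (Q := fun y =>
  exists c r v, Tspan r /\ y = delta c r v) primeL).
- by move=> a x x0; apply: lspan_mem => c r rT; apply: delta_x.
- move=> a _ [c [r [v [rT ->]]]].
  rewrite (bracket_delta (delta c r)) -[X in lspan _ (X + _)]scale1r.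
  apply: lspan_lin; apply: lspan_mem; first by exists c, r, [l a, v].
  by exists a, (delta c r), v; split=> //; apply: Tspan_delta.
- move=> x _ x0 [c [r [v [rT ->]]]];
    rewrite (bracket_delta (delta c r)) bracketC.
  rewrite (lin_opp (delta_lin c rT)) delta_x // oppr0 add0r.
  by rewrite (delta_sym st5) ?delta2_x //; apply: Tspan_delta.
- by exists (delta c0 r0 v0) => //; exists c0, r0, v0.
Qed.

Lemma delta_iter_eq0 m x :
  (forall c r, Tspan r -> iter m (delta c r) x = 0) -> x = 0.
Proof.
elim: m x => [|m IH] x x0; first by have [c [r [v [rT _]]]] := delta_neq0;
  apply: x0 c r rT.
apply: annihilator_eq0 => c' r' r'T; apply: IH => c r rT.
(* Two polarizations turn the power [m.+1] of one operator into a power [m] times an arbitrary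
   [delta c' r']: first in [r], then in [c]. *)
have polar_r c1 s : Tspan s -> iter m (delta c1 r) (delta c1 s x) = 0.
  move=> sT; apply: (@iter_polarize k L char0 _ _ (delta_lin c1 rT) (delta_lin
    c1 sT) _ m (delta c1 r x)) => [v||t].
  - by apply: Tspan_comm => //; apply: Tspan_delta.
  - by apply: Tspan_comm => //; apply: Tspan_delta.
  pose q v := r v + t *: s v.
  have qE v : delta c1 q v = delta c1 r v + t *: delta c1 s v.
    by rewrite /delta /q bracketDr bracketZr scalerBr; abel.
  have := x0 c1 q (Tspan_add rT (Tspan_scale t sT)).
  by rewrite iterSr qE (eq_iter qE).
apply: (@iter_polarize k L char0 _ _ (delta_lin c rT) (delta_lin c' rT) _ m
  (delta c r' x)) => [v||t].
- by apply: Tspan_comm => //; apply: Tspan_delta.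
- by apply: (delta_swap char0 st5).
have qE s v : Tspan s -> delta (c + t *: c') s v = delta c s v + t *: delta c'
  s v.
  by move=> sT; rewrite addrC (delta_linear v sT) addrC.
have := polar_r (c + t *: c') r' r'T.
by rewrite qE // (eq_iter (fun v => qE r v rT)).
Qed.

(** Otherwise polarization in [r] gives [(delta c r)^m (delta a s w) = 0] for independent [r] and
    [s]; then [delta_iter_eq0] and [annihilator_eq0] force [a = 0]. *)
Lemma noncentral_points a m : a <> 0 ->
  exists c r w, Tspan r /\ iter m (delta c r) (delta a r w) <> 0.
Proof.
move=> a_neq0; apply: contrapT => no_point; apply: a_neq0.
have iter0 c r w : Tspan r -> iter m (delta c r) (delta a r w) = 0.
  by move=> rT; apply: contrapT => ?; apply: no_point; exists c, r, w.
apply: annihilator_eq0 => w s sT; rewrite (delta_sym st5) //.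
apply: (@delta_iter_eq0 m) => c r rT.
apply: (@iter_polarize k L char0 _ _ (delta_lin c rT) (delta_lin c sT) _ m
  (delta a r w)) => [v||t].
- by apply: Tspan_comm => //; apply: Tspan_delta.
- rewrite (delta_swap char0 st5) //; apply: Tspan_comm => //;
    exact: Tspan_delta.
pose q v := r v + t *: s v.
have qE b v : delta b q v = delta b r v + t *: delta b s v.
  by rewrite /delta /q bracketDr bracketZr scalerBr; abel.
by have := iter0 c q w (Tspan_add rT (Tspan_scale t sT));
  rewrite qE (eq_iter (qE c)).
Qed.

(** By symmetry and commutativity the cyclic identity is [delta w r] applied to [delta_cycle]. *)
Lemma noncentral_point c r : Tspan r ->
  exists p : point L L, base p = c /\ forall a, p a = delta a r.
Proof.
move=> rT; unshelve eexists (Point (xi := fun a => delta a r) c _ _ _ _) => //.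
- by move=> w; apply: delta_linear.
- by move=> a; apply: delta_lin.
- by move=> a b w; apply: Tspan_comm => //; apply: Tspan_delta.
move=> x y z w; rewrite /= !(delta_sym st5 [l _, _] w rT).
rewrite !(Tspan_comm char0 st5 _ (Tspan_delta _ rT) (Tspan_delta w rT)).
have w_add := lin_add (delta_lin w rT).
by rewrite -!w_add (delta_cycle st5 y z x rT) (lin_zero (delta_lin w rT)).
Qed.

End NonCentralCase.

(** * Frames when all [T] lie in the centroid *)

Section CentralCase.
Variables (k : fieldType) (L : lieAlgType k).
Hypotheses (char0 : [pchar k] =i pred0) (primeL : lie_prime L) (st5 : St5 L).
Notation "[ 'l' x , y ]" := (@bracket k L x y) (format "[ 'l'  x ,  y ]").
Implicit Types (a b c f g h u v w x y z : L) (r s : L -> L).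
Hypothesis delta_eq0 : forall c r v, Tspan r -> delta c r v = 0.

Lemma central r a v : Tspan r -> r [l a, v] = [l a, r v].
Proof. by move=> rT; rewrite bracket_delta delta_eq0 ?addr0. Qed.

(** The kernel and the image of a centroid element are commuting ideals. *)
Lemma Tspan_inj r : Tspan r -> (exists v, r v <> 0) -> forall x, r x = 0 -> x =
  0.
Proof.
move=> rT [v rv]; apply: (prime_span (Q := fun y => exists v, y = r v) primeL).
- by move=> a x rx; apply: lspan_mem; rewrite central // rx bracket0r.
- by move=> a _ [w ->]; apply: lspan_mem; exists [l a, w]; rewrite central.
- move=> x _ rx [w ->]; rewrite -central // bracketC (lin_opp (Tspan_linear
    rT)).
  by rewrite central // rx bracket0r oppr0.
- by exists (r v) => //; exists v.
Qed.

Lemma T_invariant a x y z w :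
  T [l a, x] y z w + T x [l a, y] z w + T x y [l a, z] w = 0.
Proof.
have := bracket_TE a x y z w; rewrite -central; last exact: Tspan_T.
by rewrite -[LHS]addr0 => /addrI.
Qed.

Lemma center_eq0 a : a <> 0 -> exists h, [l h, a] <> 0.
Proof.
move=> a0; apply: contrapT => noh; apply: (a0).
apply: (prime_span (P := fun x =>
  forall h, [l h, x] = 0) (Q := fun=> True) primeL).
- by move=> b x x0; apply: lspan_mem => h; rewrite x0 bracket0r.
- by move=> b x _; apply: lspan_mem.
- by move=> x y x0 _; rewrite bracketC x0 oppr0.
- by exists a.
- by move=> h; apply: contrapT => ha; apply: noh; exists h.
Qed.

Lemma mulr2_eq0 v : v = - v -> v = 0.
Proof.
move=> e; apply: (mulrSn_eq0 (n := 1)) char0 _.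
by rewrite mulr2n {1}e addNr.
Qed.

Lemma T_neq0 a : a <> 0 -> exists x y z v, T x y z v <> 0.
Proof.
move=> a0; apply: contrapT => noT.
have T0 x y z v : T x y z v = 0.
  by apply: contrapT => xyzv; apply: noT; exists x, y, z, v.
have w0 w x y : [l [l w, x], [l w, y]] = 0.
  apply: (mulrSn_eq0 (n := 1)) char0 _.
  by apply/eqP; rewrite -oppr_eq0 -T_diag T0.
have swap w x v y : [l [l w, x], [l v, y]] = - [l [l v, x], [l w, y]].
  have := w0 (w + v) x y; rewrite !bracketDl !bracketDr !w0 add0r addr0.
  by move/eqP; rewrite addr_eq0 => /eqP.
have swapl w x v y : [l [l w, x], [l v, y]] = - [l [l x, w], [l v, y]].
  by rewrite (bracketC w x) bracketNl.
have swapr w x v y : [l [l w, x], [l v, y]] = - [l [l w, x], [l y, v]].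
  by rewrite (bracketC v y) bracketNr.
have metabelian w x v y : [l [l w, x], [l v, y]] = 0.
  (* The expression alternates in its four letters. Exchanging the two inner brackets is an even
     permutation, yet changes the sign. *)
  apply: mulr2_eq0; rewrite -(bracketC [l v, y]).
  rewrite swap swapl swap swapr swap swapl !opprK.
  by rewrite swapl swapr !opprK.
have [h ha] := center_eq0 a0.
apply: ha; apply: (prime_span (P := fun v => exists w x, v = [l w, x])
  (Q := fun v => exists w x, v = [l w, x]) primeL).
- by move=> b x _; apply: lspan_mem; exists b, x.
- by move=> b x _; apply: lspan_mem; exists b, x.
- by move=> _ _ [w [x ->]] [v [y ->]].
- by have [h' h'a] := center_eq0 a0; exists [l h', a] => //; exists h', a.
- by exists h, a.
Qed.

Lemma T3D h x y z v : T h x (y + z) v = T h x y v + T h x z v.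
Proof. exact: (lin_add (T_linear3 h x v)). Qed.

Lemma T2D h x y z v : T h (x + y) z v = T h x z v + T h y z v.
Proof. by rewrite !(Tcycle z) T3D. Qed.

Lemma T1D h x y z v : T (h + x) y z v = T h y z v + T x y z v.
Proof. by rewrite !(TC y) T2D opprD. Qed.

Lemma TC2 x y z v : T x y z v = - T x z y v.
Proof. by rewrite (Tcycle z) TC. Qed.

(** Otherwise polarization and invariance kill [T] whenever one of its indices is a bracket. By
    [T_perm4] a nonzero [T x y z] then kills all brackets, against its injectivity. *)
Lemma T_bracket_neq0 a : a <> 0 -> exists h x v, T h x [l h, x] v <> 0.
Proof.
move=> a0; apply: contrapT => noT.
have T0 h x v : T h x [l h, x] v = 0.
  by apply: contrapT => hxv; apply: noT; exists h, x, v.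
have T0l x y v : T 0 x y v = 0.
  by rewrite -(Tcycle 0); apply: (lin_zero (T_linear3 x y v)).
have h_h h x y v : T h x [l h, y] v = 0.
  apply: mulr2_eq0.
  have sym : T h x [l h, y] v = T h y [l h, x] v.
    have := T_invariant h h x y v; rewrite bracket_alt T0l add0r.
    by rewrite (TC2 h [l h, x] y) => /eqP; rewrite addrC subr_eq0 => /eqP.
  have := T0 h (x + y) v; rewrite bracketDr T3D !T2D !T0 add0r addr0 => /eqP.
  by rewrite addrC addr_eq0 -sym => /eqP.
have swap13 h x g y v : T h x [l g, y] v = - T g x [l h, y] v.
  have := h_h (h + g) x y v;
    rewrite bracketDl T3D !T1D !h_h add0r addr0 => /eqP.
  by rewrite addrC addr_eq0 => /eqP.
have swap34 h x g y v : T h x [l g, y] v = - T h x [l y, g] v.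
  by rewrite bracketC (lin_opp (T_linear3 h x v)).
have T_br h x g y v : T h x [l g, y] v = 0.
  (* The three terms of [T_invariant] are equal. *)
  apply: (mulrSn_eq0 (n := 2)) char0 _.
  have e1 : T [l g, h] x y v = T h x [l g, y] v.
    rewrite -(Tcycle [l g, h]) swap34 swap13 (TC y h) swap13 (TC h x) swap34.
    by rewrite !opprK.
  have e2 : T h [l g, x] y v = T h x [l g, y] v.
    by rewrite (Tcycle y) swap34 swap13 (TC h x) swap34 !opprK.
  by have := T_invariant g h x y v; rewrite e1 e2 !mulrS mulr0n addr0 addrA.
have [x [y [z [v xyz]]]] := T_neq0 a0.
have [h ha] := center_eq0 a0.
apply: ha; apply: (Tspan_inj (Tspan_T x y z)); first by exists v.
rewrite T_perm4 -(Tcycle [l h, a] y) T_br (TC2 x) !T_br; abel.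
Qed.

Lemma central_frame a : a <> 0 ->
  exists h x v, T h x [l h, x] v <> 0 /\ [l h, a] <> 0.
Proof.
move=> a0; apply: contrapT => no_frame.
have T0 h x v : [l h, a] <> 0 -> T h x [l h, x] v = 0.
  by move=> ha; apply: contrapT => hxv; apply: no_frame; exists h, x, v.
have [h0 h0a] := center_eq0 a0.
have [h [x [v hxv]]] := T_bracket_neq0 a0.
have ha : [l h, a] = 0 by apply: contrapT => ha; apply/hxv/T0.
pose C1 := T h x [l h0, x] v + T h0 x [l h, x] v.
pose C2 := T h0 x [l h0, x] v.
have Tn n : T h x [l h, x] v + C1 *+ n.+1 + C2 *+ (n.+1 * n.+1) = 0.
  have hn : [l h + n.+1%:R *: h0, a] <> 0.
    by rewrite bracketDl ha add0r bracketZl scaler_nat => /(mulrSn_eq0 char0).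
  have := T0 _ x v hn; rewrite bracketDl bracketZl T3D !T1D.
  have T3Z g y z : T g y (n.+1%:R *: z) v = T g y z v *+ n.+1.
    by rewrite (lin_scale (T_linear3 g y v)) scaler_nat.
  rewrite -!(Tcycle (_ *: _)) !T3Z !(Tcycle h0) !T3Z => <-.
  rewrite /C1 /C2 mulrnA (mulrnDl _ (T h x _ v)) !addrA.
  by congr (_ + _); rewrite addrAC.
(* Replacing [h] by [h + n h0] gives a quadratic polynomial in [n] that vanishes at 1, 2, 3; its
   value at 0 is [3 p(1) - 3 p(2) + p(3)]. *)
have := congr2 (fun u w => u *+ 3 - w *+ 3) (Tn 0%N) (Tn 1%N).
move=> /(congr2 +%R (Tn 2%N)); rewrite !mul0rn subrr addr0 => e; apply: hxv.
rewrite -[RHS]e; abel.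
Qed.

End CentralCase.

Lemma T_centroid (k : fieldType) (L : lieAlgType k) (c : L -> L) (x y z w : L) :
  linear c -> (forall u v, bracket u (c v) = c (bracket u v)) ->
  T x y (c z) w = c (T x y z w).
Proof.
move=> c_lin c_br; have c_brl u v : bracket (c u) v = c (bracket u v).
  by rewrite bracketC c_br (bracketC u) (lin_opp c_lin).
by rewrite /T !(c_br, c_brl) !(lin_add c_lin).
Qed.

(* The element P + Q sqrt s of the quadratic extension of the operator algebra,
   acting on V + V sqrt s. *)
Section QuadraticExtension.
Variables (k : fieldType) (d : opdata k) (s : opalg d).
Implicit Types (P Q : opalg d) (vw : (opspace d * opspace d)%type).

Definition sact P Q vw : (opspace d * opspace d)%type :=
  (P vw.1 + (s * Q) vw.2, Q vw.1 + P vw.2).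

Let act_linear P : linear P. Proof. by have [] := opvalP P. Qed.
Let actD P Q u : (P + Q) u = P u + Q u. Proof. by []. Qed.
Let actM P Q u : (P * Q) u = P (Q u). Proof. by []. Qed.

Lemma sactM P Q P' Q' vw :
  sact P Q (sact P' Q' vw) = sact (P * P' + s * Q * Q') (P * Q' + Q * P') vw.
Proof.
rewrite /sact /= !(lin_add (act_linear _)) -!actM; congr pair.
  by rewrite addrACA -!actD; congr (opval _ _ + opval _ _); ring.
by rewrite addrACA -!actD; congr (opval _ _ + opval _ _); ring.
Qed.

Lemma sactD P Q P' Q' vw : sact P Q vw + sact P' Q' vw = sact (P + P') (Q + Q')
  vw.
Proof. by rewrite /sact mulrDr !actD; congr pair; rewrite /= addrACA. Qed.

Lemma sact0 vw : sact 0 0 vw = 0.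
Proof. by rewrite /sact mulr0 /= !scale0r addr0. Qed.

Lemma sactZ c P Q vw : sact (op_scalar d c * P) (op_scalar d c * Q) vw = c *:
  sact P Q vw.
Proof.
rewrite /sact mulrCA; congr pair; rewrite /= scalerDr //.
Qed.

Lemma sact_linear P Q : linear (sact P Q).
Proof.
move=> c v w; rewrite /sact /= !(act_linear P, act_linear Q, act_linear s).
by congr pair; rewrite /= scalerDr addrACA.
Qed.

End QuadraticExtension.

(** * The point given by a frame over the centroid *)

Section CentralPoint.
Variables (k : fieldType) (L : lieAlgType k).
Hypotheses (char0 : [pchar k] =i pred0) (primeL : lie_prime L) (st5 : St5 L).
Notation "[ 'l' x , y ]" := (@bracket k L x y) (format "[ 'l'  x ,  y ]").
Implicit Types (a f g h u v w x y z : L).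
Hypothesis delta_eq0 : forall c r v, @Tspan k L r -> delta c r v = 0.
Variables (h x a v0 : L).
Hypotheses (frame_neq0 : T h x [l h, x] v0 <> 0) (ha_neq0 : [l h, a] <> 0).

Lemma central_point : exists p : point L (L * L)%type,
  forall m, exists vw, iter m (p (base p)) (p a vw) <> 0.
Proof.
(* The derivation required by opdata plays no role here. *)
have shift0 : linear (fun _ : L => 0 : L) by move=> c u v;
  rewrite scaler0 addr0.
have Tspan_shift s : @Tspan k L s -> Tspan (fun v => 0 - s (0 : L)).
  move=> sT; rewrite (_ : (fun v => _) = fun v => 0 *: s v).
    exact: Tspan_scale.
  by apply: funext => v; rewrite (lin_zero (Tspan_linear sT)) subr0 scale0r.
have L_nontrivial : exists v : L, v != 0.
  by exists a; apply/eqP => a0; apply: ha_neq0; rewrite a0 bracket0r.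
pose d := OpData (@Tspan_linear k L) (fun s t v sT tT =>
  Tspan_comm char0 st5 v sT tT)
  shift0 Tspan_shift L_nontrivial.
pose C := opalg d.
pose Tc u v w : C := OpAlg (opgen_in_opalg (d := d) (Tspan_T u v w)).
have actD (c e : C) u : (c + e) u = c u + e u by [].
have actN (c : C) u : (- c) u = - c u by [].
have actM (c e : C) u : (c * e) u = c (e u) by [].
have act0 u : (0 : C) u = 0 by apply: scale0r.
have act_lin (c : C) : linear c by have [] := opvalP c.
(* Each [ad u] commutes with the generators, so the bicommutant [C] lies in the centroid. *)
have act_br (c : C) u v : [l u, c v] = c [l u, v].
  have [_ c_comm] := opvalP c; rewrite (c_comm (@bracket k L u)) //; split.
    by move=> e y z; rewrite bracketDr bracketZr.
  by move=> s y sT; rewrite (central delta_eq0).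
have act_brl (c : C) u v : [l c u, v] = c [l u, v].
  by rewrite bracketC act_br (bracketC u) (lin_opp (act_lin c)).
have TcD u w y z : Tc u w (y + z) = Tc u w y + Tc u w z.
  by apply: opval_inj => t; apply: T3D.
have TcM u w (c : C) z : Tc u w (c z) = c * Tc u w z.
  apply: opval_inj => t; rewrite actM; apply: T_centroid => //; exact: act_br.
(* In the frame [h], [x], [b] the determinant is [gam], and [al], [be], [ka] are the numerators in
   Cramer's rule. *)
pose b := [l h, x].
pose gam := Tc h x b.
pose al f := Tc b f x.
pose be f := Tc b h f.
pose ka f := Tc h x f.
have coords f : gam f = al f h + be f x + ka f b.
  rewrite [LHS](T_perm4 h x b f) /= -(Tcycle b f x) -(Tcycle b h f); abel.
have beD f g : be (f + g) = be f + be g by apply: TcD.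
have kaD f g : ka (f + g) = ka f + ka g by apply: TcD.
have beM (c : C) f : be (c f) = c * be f by apply: TcM.
have kaM (c : C) f : ka (c f) = c * ka f by apply: TcM.
have be_lin (c1 c2 c3 : C) u v w :
    be (c1 u + c2 v + c3 w) = c1 * be u + c2 * be v + c3 * be w.
  by rewrite !beD !beM.
have ka_lin (c1 c2 c3 : C) u v w :
    ka (c1 u + c2 v + c3 w) = c1 * ka u + c2 * ka v + c3 * ka w.
  by rewrite !kaD !kaM.
have gam_inj u : gam u = 0 -> u = 0.
  by apply: Tspan_inj; [| | exact: Tspan_T | exists v0].
have gamI (c e : C) : gam * c = gam * e -> c = e.
  move=> ce; apply: opval_inj => t; apply/eqP; rewrite -subr_eq0;
    apply/eqP/gam_inj.
  by rewrite (lin_add (act_lin gam)) (lin_opp (act_lin gam)) -!actM ce subrr.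
have ka_h f : ka [l h, f] = be f.
  apply: opval_inj => t; have := T_invariant delta_eq0 h h x f t.
  rewrite bracket_alt -(Tcycle 0) (lin_zero (T_linear3 _ _ _)) add0r TC => /eqP.
  by rewrite addrC subr_eq0 => /eqP.
pose bb := be [l h, b].
have be_h : be h = 0 by apply: opval_inj => t; rewrite /= -Tcycle Txx scale0r.
have be_x : be x = gam by apply: opval_inj => t; rewrite /= (Tcycle b).
have be_b : be b = 0.
  by apply: opval_inj => t; rewrite /= TC2 Txx oppr0 scale0r.
have ka_b : ka b = gam by [].
have br_coords (c1 c2 c3 e1 e2 e3 : C) :
    [l c1 h + c2 x + c3 b, e1 h + e2 x + e3 b] =
    (c1 * e2 - c2 * e1) b + (c1 * e3 - c3 * e1) [l h, b]
      + (c2 * e3 - c3 * e2) [l x, b].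
  rewrite !(bracketDl, bracketDr) !(act_brl, act_br) -!actM !bracket_alt.
  rewrite (bracketC x h) (bracketC b h) (bracketC b x) -/b.
  rewrite !(lin_opp (act_lin _)) !(lin_zero (act_lin _)) !(actD, actN).
  abel.
have br2 f g : (gam * gam) [l f, g] =
    (al f * be g - be f * al g) b + (al f * ka g - ka f * al g) [l h, b]
    + (be f * ka g - ka f * be g) [l x, b].
  by rewrite actM -act_br -act_brl !coords br_coords.
have be_br f g : gam * gam * be [l f, g] =
    (al f * ka g - ka f * al g) * bb + (be f * ka g - ka f * be g) * be [l x,
      b].
  by rewrite -beM br2 be_lin be_b mulr0 add0r.
have ka_br f g : gam * gam * ka [l f, g] =
    (al f * be g - be f * al g) * gam + (be f * ka g - ka f * be g) * ka [l x,
      b].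
  by rewrite -kaM br2 ka_lin ka_b ka_h be_b mulr0 addr0.
(* With this choice [gam * be + ka * sqrt s2] is an eigenform of [ad h], of eigenvalue
   [sqrt s2 / gam]. *)
pose s2 : C := gam * bb.
have beZ (c : k) f : be (c *: f) = op_scalar d c * be f by exact: beM
  (op_scalar d c) f.
have kaZ (c : k) f : ka (c *: f) = op_scalar d c * ka f by exact: kaM
  (op_scalar d c) f.
pose xi f := sact s2 (gam * be f) (ka f).
have xi_linl vw : linear (fun f => xi f vw).
  by move=> c f g; rewrite /xi beD kaD beZ kaZ mulrDr (mulrCA gam) -sactD sactZ.
have xi_comm f g vw : xi f (xi g vw) = xi g (xi f vw).
  by rewrite /xi !sactM; congr sact; ring.
have xi_cycle y z t vw :
    xi y (xi [l z, t] vw) + xi z (xi [l t, y] vw) + xi t (xi [l y, z] vw) = 0.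
  (* The coordinates of a bracket are known only after multiplication by [gam * gam], which [gamI]
     allows to cancel. *)
  rewrite /xi !sactM !sactD -[RHS](sact0 s2 vw); congr sact; apply/gamI/gamI;
    rewrite mulr0.
    transitivity (gam * gam * be y * (gam * gam * be [l z, t])
      + s2 * ka y * (gam * gam * ka [l z, t])
      + (gam * gam * be z * (gam * gam * be [l t, y])
      + s2 * ka z * (gam * gam * ka [l t, y]))
      + (gam * gam * be t * (gam * gam * be [l y, z])
      + s2 * ka t * (gam * gam * ka [l y, z]))); first by ring.
    rewrite !be_br !ka_br /s2; ring.
  transitivity (gam * be y * (gam * gam * ka [l z, t])
      + ka y * gam * (gam * gam * be [l z, t])
      + (gam * be z * (gam * gam * ka [l t, y])
      + ka z * gam * (gam * gam * be [l t, y]))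
      + (gam * be t * (gam * gam * ka [l y, z])
      + ka t * gam * (gam * gam * be [l y, z]))); first by ring.
  rewrite !be_br !ka_br; ring.
exists (Point x xi_linl (fun f => sact_linear _ _ _) xi_comm xi_cycle) => m /=.
(* At the base, [xi] is multiplication by [gam * gam], which is injective; it then suffices that
   [xi a] is nonzero. *)
have xi_x vw : xi x vw = 0 -> vw = 0.
  have ka_x : ka x = 0 by apply: opval_inj => t;
    rewrite /= 2!(Tcycle x) Txx scale0r.
  rewrite /xi /sact ka_x be_x mulr0 /= !scale0r addr0 add0r.
  by case: vw => v w [/gam_inj/gam_inj-> /gam_inj/gam_inj->].
(* If [xi a = 0], then [gam a] is a multiple of [h] and commutes with [h], against [ha_neq0]. *)
have [vw xi_a] : exists vw, xi a vw <> 0.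
  apply: contrapT => no_vw; apply: ha_neq0.
  have xi0 v : xi a (v, 0) = 0 by apply: contrapT => xi_v; apply: no_vw;
    exists (v, 0).
  have ka0 : ka a = 0.
    apply: opval_inj => v; rewrite act0.
    have : ka a v + (gam * be a) 0 = 0 := congr1 snd (xi0 v).
    by rewrite (lin_zero (act_lin (gam * be a))) addr0.
  have be0 : be a = 0.
    apply: gamI; rewrite mulr0; apply: opval_inj => v; rewrite act0.
    have : (gam * be a) v + (s2 * ka a) 0 = 0 := congr1 fst (xi0 v).
    by rewrite (lin_zero (act_lin (s2 * ka a))) addr0.
  apply: gam_inj; rewrite -act_br coords be0 ka0 !act0 !addr0.
  by rewrite act_br bracket_alt (lin_zero (act_lin _)).
exists vw; elim: m => [|m IH] //= /xi_x; exact: IH.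
Qed.
End CentralPoint.

(** * The zero Lie algebra and the conclusion *)

(** The whole ring is a good ideal here, and the zero algebra is vacuously prime. *)
Lemma trivial_embedding (k : fieldType) (L : lieAlgType k) :
  lie_prime L -> (forall a : L, a = 0) ->
  exists (A : diffAlgType k) (f : L -> Diff A),
    [/\ diff_prime A, lie_morphism f & injective f].
Proof.
move=> primeL L0; pose D : {additive k -> k} := \0.
apply: (@prime_quotient k L k idfun D (fun=> 0) _ _ _ setT) => //.
- by move=> a b; rewrite /D /= mul0r mulr0 addr0.
- by move=> c x y; rewrite mulr0 addr0.
- by split=> //; split.
Qed.

Theorem theorem1 (k : fieldType) (char0 : [pchar k] =i pred0)
  (L : lieAlgType k) (primeL : lie_prime L) (st5L : St5 L) :
  exists (A : diffAlgType k) (f : L -> Diff A),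
    [/\ diff_prime A, lie_morphism f & injective f].
Proof.
have [a_neq0|L0] := pselect (exists a : L, a <> 0); last first.
  apply: trivial_embedding => // a; apply: contrapT => a_neq0.
  by apply: L0; exists a.
have [delta_neq0|delta0] :=
    pselect (exists c r v, @Tspan k L r /\ delta c r v <> 0).
  apply: (@embedding k L L) => // a m a0.
  have [c [r [w [rT w_neq0]]]] := noncentral_points char0 primeL st5L
    delta_neq0 m a0.
  have [p [pc pE]] := noncentral_point char0 st5L c rT.
  by exists p, w; rewrite pc !pE.
have delta_eq0 c r v : @Tspan k L r -> delta c r v = 0.
  by move=> rT; apply: contrapT => crv; apply: delta0; exists c, r, v.
apply: (@embedding k L (L * L)%type) => // a m a0.
have [h [x [v [frame_neq0 ha_neq0]]]] := central_frame char0 primeL delta_eq0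
  a0.
have [p /(_ m)] := central_point char0 primeL st5L delta_eq0 frame_neq0 ha_neq0.
by exists p.
Qed.
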